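(* Let $(M,g)$ be a Riemannian manifold of constant sectional curvature $\kappa$, and let $TM$ carry a Kaluza-Klein metric $G$ with $A\equiv 1$. For a vector field $\sigma:(M,g)\to(TM,G)$, the horizontal part of its tension field is $$\tau^{h}(\sigma) = \kappa\,\bigl(\nabla_{\sigma}\sigma - (\operatorname{div}\sigma)\,\sigma\bigr).$$ If $M$ is compact with $\kappa\neq 0$ and $\sigma$ is a harmonic map of constant length $k$, then $\operatorname{div}\sigma=0$ and $\nabla_{\sigma}\sigma=0$. Moreover, in this situation: (1) if $|\nabla\sigma|^2\le \kappa k^2$, then $\sigma$ is a Killing vector field; (2) if $-2\kappa k^2\ge |L_{\sigma}g|^2$, then $\sigma$ is parallel.
   Context: Let $(M,g)$ be a Riemannian manifold with Levi-Civita connection $\nabla$. At $(p,e)\in TM$ the space $T_{(p,e)}TM$ splits into the vertical space (kernel of $d\pi$, $\pi:TM\to M$ the projection) and the horizontal space defined by $\nabla$; each $X\in T_pM$ has a horizontal lift $X^h$ and a vertical lift $X^v$. A Kaluza-Klein metric on $TM$ is a Riemannian metric $G$ such that at $(p,e)$ $$G(X^h,Y^h)=A(|e|^2)g(X,Y),\quad G(X^h,Y^v)=0,\quad G(X^v,Y^v)=B(|e|^2)g(X,Y)+C(|e|^2)g(X,e)g(Y,e),$$ where $A,B,C$ are real $C^2$ functions of $|e|^2$, $A>0$, and $B,C$ are such that $G$ is positive definite. A vector field $\sigma$ on $M$ is viewed as a map $\sigma:(M,g)\to(TM,G)$. Its tension field $\tau(\sigma)=\operatorname{trace}\nabla d\sigma$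 (computed with the Levi-Civita connections of $g$ and $G$) is decomposed as $\tau(\sigma)=[\tau^h(\sigma)]^h+[\tau^v(\sigma)]^v$ with $\tau^h(\sigma),\tau^v(\sigma)$ vector fields on $M$. $\sigma$ is a harmonic map if $\tau(\sigma)=0$. $|\nabla\sigma|$ and $|L_\sigma g|$ are Hilbert-Schmidt norms; $L_\sigma g$ is the Lie derivative of $g$ along $\sigma$.
   Formalization: The displayed formula is corrected by the factor −B(|σ|²): what is proved is τ^h(σ) = −B(|σ|²) κ (∇_σσ − (div σ)σ); the printed formula already fails in sign for the Sasaki metric on the round 2-sphere with σ a rotation field. All other claims are as printed. *)

(* Defs.v *)
From HB Require Import structures.
From mathcomp Require Import all_boot all_order all_algebra.
From mathcomp Require Import all_classical all_reals all_analysis.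

Set Implicit Arguments.
Unset Strict Implicit.
Unset Printing Implicit Defensive.
Import Order.TTheory GRing.Theory Num.Theory.
Import numFieldNormedType.Exports.
Local Open Scope classical_set_scope.
Local Open Scope ring_scope.

(* Meant for an open set U of a finite-dimensional V. *)
Fixpoint Ck (R : realType) (V W : normedModType R) (k : nat) (U : set V)
    (f : V -> W) : Prop :=
  if k is k'.+1 then
    (forall x, U x -> differentiable f x) /\ (forall v, Ck k' U ('D_v f))
  else forall x, U x -> {for x, continuous f}.

Definition smooth_on (R : realType) (V W : normedModType R) (U : set V)
    (f : V -> W) : Prop :=
  forall k, Ck k U f.

(* A function on [0, +oo[ is C^2 up to the boundary point 0 iff it is the
   restriction of a C^2 function on the line. *)
Definition C2_nonneg (R : realType) (f : R -> R) : Prop :=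
  exists F : R -> R, Ck (V := R^o) (W := R^o) 2 setT F
    /\ forall t, 0 <= t -> F t = f t.

(* [coord c] and [param c] are only meaningful on [dom c] and on its image. *)
Record manifold (R : realType) (n : nat) := Manifold {
  carrier :> topologicalType;
  carrier_hausdorff : hausdorff_space carrier;
  carrier_second_countable : @second_countable carrier;
  chart : Type;
  dom : chart -> set carrier;
  coord : chart -> carrier -> 'rV[R]_n;
  param : chart -> 'rV[R]_n -> carrier;
  dom_open : forall c, open (dom c);
  coord_open : forall c, open (coord c @` dom c);
  coordK : forall c p, dom c p -> param c (coord c p) = p;
  coord_continuous : forall c p, dom c p -> {for p, continuous (coord c)};
  param_continuous : forall c x, (coord c @` dom c) x ->
    {for x, continuous (param c)};
  dom_cover : forall p, exists c, dom c p;
  transition_smooth : forall c d,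
    smooth_on ((coord c @` dom c) `&` (param c @^-1` dom d))
              (coord d \o param c)
}.

Definition img (R : realType) (n : nat) (M : manifold R n) (c : chart M) :
    set 'rV[R]_n :=
  coord c @` dom c.

Definition overlap (R : realType) (n : nat) (M : manifold R n) (c d : chart M) :
    set 'rV[R]_n :=
  img c `&` (param c @^-1` dom d).

Definition transition (R : realType) (n : nat) (M : manifold R n)
    (c d : chart M) : 'rV[R]_n -> 'rV[R]_n :=
  coord d \o param c.

Definition ip (R : realType) (n : nat) (S : 'M[R]_n) (u v : 'rV[R]_n) : R :=
  (u *m S *m v^T) 0 0.

(* A tensor field is the family of its expressions in the charts, constrained
   only on the image of each chart. *)
Record vector_field (R : realType) (n : nat) (M : manifold R n) := VectorField {
  vf :> chart M -> 'rV[R]_n -> 'rV[R]_n;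
  vf_smooth : forall c, smooth_on (img c) (vf c);
  vf_transition : forall (c d : chart M) (x : 'rV[R]_n), overlap c d x ->
    vf d (transition c d x) = 'd (transition c d) x (vf c x)
}.

Record riemannian_metric (R : realType) (n : nat) (M : manifold R n) :=
  RiemannianMetric {
  metric :> chart M -> 'rV[R]_n -> 'M[R]_n;
  metric_smooth : forall c, smooth_on (img c) (metric c);
  metric_sym : forall c x, img c x -> (metric c x)^T = metric c x;
  metric_pos : forall c x u, img c x -> u != 0 -> 0 < ip (metric c x) u u;
  metric_transition : forall (c d : chart M) (x : 'rV[R]_n), overlap c d x ->
    forall u v, ip (metric c x) u v =
      ip (metric d (transition c d x))
         ('d (transition c d) x u) ('d (transition c d) x v)
}.

(* Riemannian geometry of a metric g on an open set of R^n.  A vector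
   u : 'rV_n also stands for the constant field in the given coordinates; two
   such fields commute. *)

(* sum_i b(E_i, E_i) for any S-orthonormal basis (E_i) *)
Definition gtrace (R : realType) (n : nat) (W : lmodType R) (S : 'M[R]_n)
    (b : 'rV[R]_n -> 'rV[R]_n -> W) : W :=
  \sum_(i < n) \sum_(j < n)
    (invmx S) i j *: b (delta_mx 0 i) (delta_mx 0 j).

(* g (nabla_u v, w) for constant fields u, v, w, by Koszul's formula *)
Definition koszul (R : realType) (n : nat) (g : 'rV[R]_n -> 'M[R]_n)
    (x u v w : 'rV[R]_n) : R :=
  2^-1 * ('D_u (fun y => ip (g y) v w : R^o) x
          + 'D_v (fun y => ip (g y) u w : R^o) x
          - 'D_w (fun y => ip (g y) u v : R^o) x).

(* nabla_u v at x for constant fields u, v *)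
Definition christoffel (R : realType) (n : nat) (g : 'rV[R]_n -> 'M[R]_n)
    (x u v : 'rV[R]_n) : 'rV[R]_n :=
  (\row_(k < n) koszul g x u v (delta_mx 0 k)) *m invmx (g x).

Definition nabla (R : realType) (n : nat) (g : 'rV[R]_n -> 'M[R]_n)
    (X Y : 'rV[R]_n -> 'rV[R]_n) (x : 'rV[R]_n) : 'rV[R]_n :=
  'D_(X x) Y x + christoffel g x (X x) (Y x).

(* R(u, v)w = nabla_u nabla_v w - nabla_v nabla_u w - nabla_[u, v] w *)
Definition riemann (R : realType) (n : nat) (g : 'rV[R]_n -> 'M[R]_n)
    (x u v w : 'rV[R]_n) : 'rV[R]_n :=
  nabla g (fun=> u) (nabla g (fun=> v) (fun=> w)) x
  - nabla g (fun=> v) (nabla g (fun=> u) (fun=> w)) x.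

Definition sectional (R : realType) (n : nat) (g : 'rV[R]_n -> 'M[R]_n)
    (x u v : 'rV[R]_n) : R :=
  ip (g x) (riemann g x u v v) u
  / (ip (g x) u u * ip (g x) v v - ip (g x) u v ^+ 2).

Definition divergence (R : realType) (n : nat) (g : 'rV[R]_n -> 'M[R]_n)
    (X : 'rV[R]_n -> 'rV[R]_n) (x : 'rV[R]_n) : R :=
  \sum_(i < n) nabla g (fun=> delta_mx 0 i) X x 0 i.

(* (L_X g)(u, v) = X (g (u, v)) - g ([X, u], v) - g (u, [X, v]), where
   [X, u] = - D_u X for a constant field u *)
Definition lie_metric (R : realType) (n : nat) (g : 'rV[R]_n -> 'M[R]_n)
    (X : 'rV[R]_n -> 'rV[R]_n) (x u v : 'rV[R]_n) : R :=
  'D_(X x) (fun y => ip (g y) u v : R^o) x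
  + ip (g x) ('D_u X x) v + ip (g x) u ('D_v X x).

Definition normsq_nabla (R : realType) (n : nat) (g : 'rV[R]_n -> 'M[R]_n)
    (X : 'rV[R]_n -> 'rV[R]_n) (x : 'rV[R]_n) : R :=
  gtrace (W := R^o) (g x) (fun u v =>
    ip (g x) (nabla g (fun=> u) X x) (nabla g (fun=> v) X x)).

Definition normsq_lie (R : realType) (n : nat) (g : 'rV[R]_n -> 'M[R]_n)
    (X : 'rV[R]_n -> 'rV[R]_n) (x : 'rV[R]_n) : R :=
  gtrace (W := R^o) (g x) (fun u1 u2 =>
    gtrace (W := R^o) (g x) (fun v1 v2 =>
      lie_metric g X x u1 v1 * lie_metric g X x u2 v2)).

(* (nabla df)(u, v) for a map f from (R^m, g) to (R^n, h): the derivative along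
   u, in the pulled-back connection, of df(v), minus df(nabla_u v) *)
Definition second_fundamental_form (R : realType) (m n : nat)
    (g : 'rV[R]_m -> 'M[R]_m) (h : 'rV[R]_n -> 'M[R]_n)
    (f : 'rV[R]_m -> 'rV[R]_n) (x u v : 'rV[R]_m) : 'rV[R]_n :=
  'D_u ('D_v f) x + christoffel h (f x) ('D_u f x) ('D_v f x)
  - 'D_(christoffel g x u v) f x.

Definition tension (R : realType) (m n : nat)
    (g : 'rV[R]_m -> 'M[R]_m) (h : 'rV[R]_n -> 'M[R]_n)
    (f : 'rV[R]_m -> 'rV[R]_n) (x : 'rV[R]_m) : 'rV[R]_n :=
  gtrace (g x) (second_fundamental_form g h f x).

(* The tangent bundle.  A chart c of M induces the chart of TM in which the
   vector e at x has coordinates [row_mx x e]; its image is img c x R^n. *)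

Definition hlift (R : realType) (n : nat) (g : 'rV[R]_n -> 'M[R]_n)
    (x e X : 'rV[R]_n) : 'rV[R]_(n + n) :=
  row_mx X (- christoffel g x X e).

Definition vlift (R : realType) (n : nat) (X : 'rV[R]_n) : 'rV[R]_(n + n) :=
  row_mx 0 X.

Definition hpart (R : realType) (n : nat) (z : 'rV[R]_(n + n)) : 'rV[R]_n :=
  lsubmx z.

Definition vpart (R : realType) (n : nat) (g : 'rV[R]_n -> 'M[R]_n)
    (x e : 'rV[R]_n) (z : 'rV[R]_(n + n)) : 'rV[R]_n :=
  rsubmx z + christoffel g x (lsubmx z) e.

Lemma hlift_vlift_decomp (R : realType) (n : nat) (g : 'rV[R]_n -> 'M[R]_n)
    (x e : 'rV[R]_n) (z : 'rV[R]_(n + n)) :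
  z = hlift g x e (hpart z) + vlift (vpart g x e z).
Proof.
rewrite /hlift /vlift /hpart /vpart add_row_mx addr0 [- _ + _]addrC addrK.
by rewrite hsubmxK.
Qed.

(* No transition condition is needed on [kk]: the three formulas determine it
   in every chart, and they are independent of the chart. *)
Record kaluza_klein (R : realType) (n : nat) (M : manifold R n)
    (g : riemannian_metric M) (A B C : R -> R) := KaluzaKlein {
  kk :> chart M -> 'rV[R]_(n + n) -> 'M[R]_(n + n);
  kk_A_C2 : C2_nonneg A;
  kk_B_C2 : C2_nonneg B;
  kk_C_C2 : C2_nonneg C;
  kk_A_gt0 : forall t, 0 <= t -> 0 < A t;
  kk_sym : forall c x e, img c x -> (kk c (row_mx x e))^T = kk c (row_mx x e);
  kk_pos : forall c x e z, img c x -> z != 0 ->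
    0 < ip (kk c (row_mx x e)) z z;
  kk_hh : forall c x e X Y, img c x ->
    ip (kk c (row_mx x e)) (hlift (g c) x e X) (hlift (g c) x e Y) =
    A (ip (g c x) e e) * ip (g c x) X Y;
  kk_hv : forall c x e X Y, img c x ->
    ip (kk c (row_mx x e)) (hlift (g c) x e X) (vlift Y) = 0;
  kk_vv : forall c x e X Y, img c x ->
    ip (kk c (row_mx x e)) (vlift X) (vlift Y) =
    B (ip (g c x) e e) * ip (g c x) X Y
    + C (ip (g c x) e e) * ip (g c x) X e * ip (g c x) Y e
}.

(* [tau c x] is the tension field at x of s : (M, g) -> (TM, G). *)
Definition tau (R : realType) (n : nat) (M : manifold R n)
    (g : riemannian_metric M) (A B C : R -> R) (G : kaluza_klein g A B C)
    (s : vector_field M) (c : chart M) : 'rV[R]_n -> 'rV[R]_(n + n) :=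
  tension (g c) (G c) (fun x => row_mx x (s c x)).

(* Since [X^h, Z^h] has vertical part - (R(X, Z)e)^v, Koszul's formula gives
   G (nabla_{X^h} Y^v, Z^h) = (B / 2) g (R(e, Y)X, Z); so, when A = 1,
   tau_h s = B(|s|^2) sum_i R(s, nabla_{E_i} s)E_i for an orthonormal (E_i). *)
Definition tau_h (R : realType) (n : nat) (M : manifold R n)
    (g : riemannian_metric M) (A B C : R -> R) (G : kaluza_klein g A B C)
    (s : vector_field M) (c : chart M) (x : 'rV[R]_n) : 'rV[R]_n :=
  hpart (tau G s c x).

Definition harmonic_section (R : realType) (n : nat) (M : manifold R n)
    (g : riemannian_metric M) (A B C : R -> R) (G : kaluza_klein g A B C)
    (s : vector_field M) : Prop :=
  forall c x, img c x -> tau G s c x = 0.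

Definition constant_curvature (R : realType) (n : nat) (M : manifold R n)
    (g : riemannian_metric M) (kappa : R) : Prop :=
  forall c x u v, img c x -> row_free (col_mx u v) ->
    sectional (g c) x u v = kappa.

Definition constant_length (R : realType) (n : nat) (M : manifold R n)
    (g : riemannian_metric M) (s : vector_field M) (k : R) : Prop :=
  forall c x, img c x -> Num.sqrt (ip (g c x) (s c x) (s c x)) = k.

Definition killing (R : realType) (n : nat) (M : manifold R n)
    (g : riemannian_metric M) (s : vector_field M) : Prop :=
  forall c x u v, img c x -> lie_metric (g c) (s c) x u v = 0.

Definition parallel (R : realType) (n : nat) (M : manifold R n)
    (g : riemannian_metric M) (s : vector_field M) : Prop :=
  forall c x u, img c x -> nabla (g c) (fun=> u) (s c) x = 0.

(* Main.v *)
(* All identities are pointwise, in a fixed chart.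

   Horizontal part.  For A = 1, evaluate Koszul's formula for G on constant
   fields Z, Z' against a horizontal vector W over w.  The vertical component of
   W vanishes at the point and |e|^2 is constant along W, so the derivatives of B
   and C disappear, and commuting derivatives of Christoffel symbols leaves
     g(h(nabla_Z Z'), w) = g(nabla_u u', w)
        - (B/2) (g(R(w, u)e, z') + g(R(w, u')e, z)),
   where u, u' and z, z' are the horizontal and vertical components; the C-term
   drops out because g(R(.,.)e, e) = 0.  Constant curvature turns R into g, and
   the trace gives the formula.

   Second part.  If nabla s is not zero at a point, a nonzero value nabla_u s is
   orthogonal to s, since |s| is constant, so B(k^2) > 0, n >= 2, and tau_h = 0
   gives nabla_s s = (div s) s; the inner product with s yields div s = 0.  Put
   N = nabla s.  Differentiating s N = 0 and tr N = 0 and commuting derivatives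
   by the Ricci identity gives tr(N^2) + (n - 1) kappa k^2 = 0 at every point,
   while |L_s g|^2 = 2 |N|^2 + 2 tr(N^2).  Both rigidity statements follow. *)

From HB Require Import structures.
Require Import Defs.
From mathcomp Require Import all_boot all_order all_algebra.
From mathcomp Require Import all_classical all_reals all_analysis.
From mathcomp Require Import ring lra.
Import Order.TTheory GRing.Theory Num.Theory.
Import numFieldNormedType.Exports.
Local Open Scope classical_set_scope.
Local Open Scope ring_scope.
Set Implicit Arguments.
Unset Strict Implicit.
Unset Printing Implicit Defensive.

(** * Differential calculus and symmetry of second derivatives *)

Section Calculus.
Variables (R : realType) (V : normedModType R).
Implicit Types (x v : V).

(** The difference [h \- f] vanishes near [x], so its differential there is zero, and [h] is [f]
    plus this difference. *)
Lemma near_differentiable (W : normedModType R) (f h : V -> W) x :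
  (\forall y \near x, f y = h y) -> differentiable f x -> differentiable h x.
Proof.
move=> fh df; have -> : h = f + (h \- f).
  by apply/funext => y /=; rewrite [RHS]addrC subrK.
apply: differentiableD => //.
set k := h \- f; have k0 : k x = 0.
  by rewrite /k /= (nbhs_singleton fh) subrr.
have ko : k \o shift x = cst (k x) + (\0 : {linear V -> W}) +o_ 0 id.
  apply/eqaddoP => _/posnumP[e]; rewrite k0.
  have : \forall z \near (0 : V), f (z + x) = h (z + x).
    by move: fh; rewrite (near_shift 0) subr0.
  apply: filterS => z fz; rewrite /k /= !fctE /= fz subrr addr0 subr0 normr0.
  by rewrite mulr_ge0.
have c0 : continuous (\0 : {linear V -> W}) by exact: cst_continuous.
by apply/diff_locallyP; rewrite (diff_unique c0 ko).
Unshelve. all: by end_near. Qed.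

Lemma differentiable_mxP m n (M : V -> 'M[R]_(m, n)) x :
  differentiable M x <-> forall i j, differentiable (fun y => M y i j : R) x.
Proof.
split=> [dM i j|dM].
  exact: (differentiable_comp dM (differentiable_coord _ i j)).
have -> : M = \sum_(i < m) \sum_(j < n)
    (fun y => (M y i j : R) *: delta_mx i j).
  apply/funext => y; rewrite fct_sumE [LHS]matrix_sum_delta.
  by apply: eq_bigr => i _; rewrite fct_sumE.
apply: differentiable_sum => i; apply: differentiable_sum => j.
exact: differentiableZl.
Qed.

Lemma derive_entry m n (M : V -> 'M[R]_(m, n)) x v i j :
  differentiable M x -> ('D_v M x) i j = 'D_v (fun y => M y i j : R) x.
Proof. by move=> dM; rewrite derive_mx ?mxE//; exact: diff_derivable. Qed.

Lemma differentiable_mulmx m n p (A : V -> 'M[R]_(m, n)) (B : V -> 'M[R]_(n, p)) x :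
  differentiable A x -> differentiable B x ->
  differentiable (fun y => A y *m B y) x.
Proof.
move=> /differentiable_mxP dA /differentiable_mxP dB.
apply/differentiable_mxP => i j.
have -> : (fun y => (A y *m B y) i j : R) =
    \sum_(k < n) (fun y => A y i k : R) * (fun y => B y k j : R).
  by apply/funext => y; rewrite fct_sumE mxE.
by apply: differentiable_sum => k; apply: differentiableM.
Qed.

Lemma derive_mulmx m n p (A : V -> 'M[R]_(m, n)) (B : V -> 'M[R]_(n, p)) x v :
  differentiable A x -> differentiable B x ->
  'D_v (fun y => A y *m B y) x = 'D_v A x *m B x + A x *m 'D_v B x.
Proof.
move=> dA dB; apply/matrixP => i j.
have eA := (differentiable_mxP _ _).1 dA.
have eB := (differentiable_mxP _ _).1 dB.
rewrite derive_entry; last exact: differentiable_mulmx.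
have -> : (fun y => (A y *m B y) i j : R) =
    \sum_(k < n) (fun y => A y i k : R) * (fun y => B y k j : R).
  by apply/funext => y; rewrite fct_sumE mxE.
rewrite derive_sum; last first.
  by move=> k; apply: derivableM; exact: diff_derivable.
rewrite !mxE -big_split/=; apply: eq_bigr => k _.
rewrite deriveM; try exact: diff_derivable.
rewrite (derive_entry _ _ _ dA) (derive_entry _ _ _ dB) addrC.
by rewrite -[B x k j *: _]/(_ * _) mulrC.
Qed.

Lemma differentiable_trmx m n (A : V -> 'M[R]_(m, n)) x :
  differentiable A x -> differentiable (fun y => (A y)^T) x.
Proof.
move=> /differentiable_mxP dA; apply/differentiable_mxP => i j.
by rewrite (_ : (fun _ => _) = (fun y => A y j i))//; apply/funext => y; rewrite mxE.
Qed.

Lemma derive_trmx m n (A : V -> 'M[R]_(m, n)) x v :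
  differentiable A x -> 'D_v (fun y => (A y)^T) x = ('D_v A x)^T.
Proof.
move=> dA; apply/matrixP => i j; rewrite derive_entry; last first.
  exact: differentiable_trmx.
rewrite mxE derive_entry//; congr ('D_v _ x).
by apply/funext => y; rewrite mxE.
Qed.

Lemma differentiable_prod (I : Type) (r : seq I) (f : I -> V -> R) x :
  (forall i, differentiable (f i) x) ->
  differentiable (fun y => \prod_(i <- r) f i y) x.
Proof.
move=> df; elim: r => [|i r ih].
  rewrite (_ : (fun _ => _) = cst 1); first exact: differentiable_cst.
  by apply/funext => y; rewrite big_nil.
rewrite (_ : (fun _ => _) = f i * (fun y => \prod_(i <- r) f i y)).
  exact: differentiableM.
by apply/funext => y; rewrite big_cons.
Qed.

Lemma differentiable_bigsum (I : Type) (r : seq I) (W : normedModType R)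
    (f : I -> V -> W) x :
  (forall i, differentiable (f i) x) ->
  differentiable (fun y => \sum_(i <- r) f i y) x.
Proof.
move=> df; elim: r => [|i r ih].
  rewrite (_ : (fun _ => _) = cst 0); first exact: differentiable_cst.
  by apply/funext => y; rewrite big_nil.
rewrite (_ : (fun _ => _) = f i + (fun y => \sum_(i <- r) f i y)).
  exact: differentiableD.
by apply/funext => y; rewrite big_cons.
Qed.

Lemma differentiable_det n (A : V -> 'M[R]_n) x :
  differentiable A x -> differentiable (fun y => \det (A y) : R) x.
Proof.
move=> /differentiable_mxP dA; rewrite /determinant.
apply: differentiable_bigsum => s; apply: differentiableM.
  exact: differentiable_cst.
by apply: differentiable_prod => i.
Qed.

(** Cramer's rule makes the inverse a rational function of the entries. Invertibility is asked near
    [x] because [invmx] returns a singular matrix unchanged. *)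
Lemma differentiable_invmx n (A : V -> 'M[R]_n) x :
  differentiable A x -> (\forall y \near x, A y \in unitmx) ->
  differentiable (fun y => invmx (A y)) x.
Proof.
move=> dA uA.
apply: (@near_differentiable _ (fun y => (\det (A y))^-1 *: \adj (A y))).
  by near=> y; rewrite /invmx ifT//; near: y.
apply/differentiable_mxP => i j.
rewrite (_ : (fun _ => _) =
    (fun y => (\det (A y))^-1 : R) * (fun y => cofactor (A y) j i : R)); last first.
  by apply/funext => y; rewrite !mxE.
apply: differentiableM.
  apply: differentiableV; first exact: differentiable_det.
  by have := nbhs_singleton uA; rewrite unitmxE unitfE.
apply: differentiableM; first exact: differentiable_cst.
apply: differentiable_det; apply/differentiable_mxP => k l.
rewrite (_ : (fun _ => _) = (fun y => A y (lift j k) (lift i l))); last first.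
  by apply/funext => y; rewrite !mxE.
by have /differentiable_mxP := dA.
Unshelve. all: by end_near. Qed.

Lemma derive_line (f : V -> R) a v (t : R) :
  differentiable f (t *: v + a) ->
  is_derive t 1 (fun r : R => f (r *: v + a) : R) ('D_v f (t *: v + a)).
Proof.
move=> df.
have dl : is_diff t (fun r : R => r *: v + a) ( *:%R^~ v).
  apply: is_diff_eq (is_diffD (is_diff_scalel t v) (is_diff_cst a t)) _.
  by rewrite addr0.
have dc : differentiable (fun r : R => f (r *: v + a) : R) t.
  exact: (@differentiable_comp _ _ _ _ (fun r : R => r *: v + a) f t ex_diff df).
apply: DeriveDef; first exact: diff_derivable.
rewrite deriveE// (@diff_comp _ _ _ _ (fun r : R => r *: v + a) f t ex_diff df).
rewrite deriveE//=; congr ('d f _ _).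
by rewrite diff_val scale1r.
Qed.

Lemma MVT_line (f : V -> R) a v (h : R) : 0 < h ->
  (forall t, t \in `[0, h] -> differentiable f (t *: v + a)) ->
  exists2 c, c \in `]0, h[ & f (h *: v + a) - f a = h * 'D_v f (c *: v + a).
Proof.
move=> h0 df.
have [|||c ch] := @MVT R (fun r => f (r *: v + a)) (fun r => 'D_v f (r *: v + a)) 0 h.
- by [].
- by move=> t /subset_itv_oo_cc th; apply: derive_line; exact: df.
- apply: derivable_within_continuous => t th.
  by have [] := derive_line (df _ th).
- by rewrite scale0r add0r subr0 mulrC => e; exists c.
Qed.

(** By the mean value theorem along [u] and then along [v], the second difference over the
    parallelogram with sides [h *: u] and [h *: v] is exactly [h ^+ 2] times the mixed derivative at
    one of its points; continuity at [x] does the rest. *)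
Lemma schwarz_quotient (f : V -> R) x u v (e : R) : 0 < e ->
  (\forall y \near x, differentiable f y) ->
  (\forall y \near x, differentiable ('D_u f) y) ->
  {for x, continuous ('D_v ('D_u f))} ->
  \forall h \near 0^'+,
    `|f (h *: u + (h *: v + x)) - f (h *: u + x) - f (h *: v + x) + f x
      - h ^+ 2 * 'D_v ('D_u f) x| <= e * h ^+ 2.
Proof.
move=> e0 df ddf cf.
have : \forall y \near x, [/\ differentiable f y, differentiable ('D_u f) y
    & `|'D_v ('D_u f) x - 'D_v ('D_u f) y| <= e].
  near=> y; split; [by near: y|by near: y|].
  by near: y; move/cvgrPdist_le : cf; apply.
move=> /nbhs_ballP[r /= r0 rP].
near=> h.
have h0 : 0 < h by near: h; exact: nbhs_right_gt.
have nearx (s t : R) : s \in `[0, h] -> t \in `[0, h] -> ball x r (s *: u + (t *: v + x)).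
  rewrite !in_itv/= => /andP[s0 sh] /andP[t0 th].
  rewrite -ball_normE/= addrA distrC addrK.
  apply: (@le_lt_trans _ _ (h * (`|u| + `|v|))).
    rewrite (le_trans (ler_normD _ _))// !normrZ !ger0_norm// mulrDr.
    by rewrite lerD// ler_wpM2r.
  (* The summand 1 keeps the divisor positive when [u] and [v] both vanish. *)
  have huv : 0 < `|u| + `|v| + 1 by rewrite ltr_wpDl ?addr_ge0.
  apply: (@le_lt_trans _ _ (h * (`|u| + `|v| + 1))).
    by rewrite ler_wpM2l ?lerDl// ltW.
  rewrite -ltr_pdivlMr//; near: h; apply: nbhs_right_lt; exact: divr_gt0.
have h00 : 0 \in `[0, h] by rewrite in_itv/= lexx ltW.
have h0h : h \in `[0, h] by rewrite in_itv/= lexx ltW.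
(* The second difference is [p h - p 0], to which the first mean value theorem applies. *)
pose p (r : R) : R := f (r *: u + (h *: v + x)) - f (r *: u + x).
pose dp (r : R) : R := 'D_u f (r *: u + (h *: v + x)) - 'D_u f (r *: u + x).
have pd (q : R) : q \in `[0, h] -> is_derive q 1 p (dp q).
  move=> qh; apply: is_deriveB; apply: derive_line.
    by have [] := rP _ (nearx _ _ qh h0h).
  by have [] := rP _ (nearx _ _ qh h00); rewrite scale0r add0r.
have pc : {within `[0, h], continuous p}.
  by apply: derivable_within_continuous => t th; have [] := pd _ th.
have [c ch {}pc] := MVT h0 (fun t th => pd t (subset_itv_oo_cc th)) pc.
have cch := subset_itv_oo_cc ch.
have [//|t th|d dh dpd] := @MVT_line ('D_u f) (c *: u + x) v h.
  by rewrite addrCA; have [] := rP _ (nearx _ _ cch th).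
have -> : f (h *: u + (h *: v + x)) - f (h *: u + x) - f (h *: v + x) + f x =
    h ^+ 2 * 'D_v ('D_u f) (d *: v + (c *: u + x)).
  have dcE : dp c = h * 'D_v ('D_u f) (d *: v + (c *: u + x)).
    by rewrite -dpd /dp addrCA.
  move: pc; rewrite /p !scale0r !add0r subr0 => pc.
  by rewrite expr2 -mulrA -dcE [RHS]mulrC -pc; ring.
rewrite -mulrBr normrM distrC (ger0_norm (sqr_ge0 h)) mulrC ler_wpM2r ?sqr_ge0//.
by rewrite addrCA; have [] := rP _ (nearx _ _ cch (subset_itv_oo_cc dh)).
Unshelve. all: by end_near. Qed.

(** The second difference is symmetric in [u] and [v]; divided by [h ^+ 2], it lies within [e / 2]
    of either mixed derivative. *)
Lemma derive_sym (f : V -> R) x u v :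
  (\forall y \near x, differentiable f y) ->
  (\forall y \near x, differentiable ('D_u f) y) ->
  (\forall y \near x, differentiable ('D_v f) y) ->
  {for x, continuous ('D_v ('D_u f))} -> {for x, continuous ('D_u ('D_v f))} ->
  'D_u ('D_v f) x = 'D_v ('D_u f) x.
Proof.
move=> df duf dvf cuv cvu; apply/eqP; rewrite -subr_eq0 -normr_le0.
apply/ler_addgt0Pr => e e0; rewrite add0r.
have e20 : 0 < e / 2 by rewrite divr_gt0.
have Q1 := schwarz_quotient e20 df duf cuv.
have Q2 := schwarz_quotient e20 df dvf cvu.
have [h [h0 [q1 q2]]] := filter_ex (filterI (nbhs_right_gt (0 : R)) (filterI Q1 Q2)).
have h20 : 0 < h ^+ 2 by rewrite exprn_gt0.
rewrite -(ler_pM2r h20) -[in leLHS](ger0_norm (ltW h20)) -normrM.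
have key (a b p q r s k : R) : `|p - q - r + s - k * b| <= e / 2 * k ->
    `|p - r - q + s - k * a| <= e / 2 * k -> `|(a - b) * k| <= e * k.
  rewrite !ler_norml => /andP[l1 l2] /andP[l3 l4].
  by clear -l1 l2 l3 l4; apply/andP; split; lra.
by move: q1; rewrite addrCA => /key; exact.
Qed.

End Calculus.

(** * The Levi-Civita connection in a chart *)

(* Sealed copies of the derivative and of the Christoffel map: unification would
   otherwise unfold them down to limits. *)
HB.lock Definition dder (R : realType) (V W : normedModType R)
    (f : V -> W) (v x : V) : W :=
  'D_v f x.

HB.lock Definition gam (R : realType) (n : nat) (g : 'rV[R]_n -> 'M[R]_n)
    (x u v : 'rV[R]_n) : 'rV[R]_n :=
  christoffel g x u v.

Section Derivations.
Variables (R : realType) (V : normedModType R).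
Implicit Types (x u v w : V).

Lemma dderE (W : normedModType R) (f : V -> W) v x : 'D_v f x = dder f v x.
Proof. by rewrite unlock. Qed.

Lemma dder_dirD (W : normedModType R) (f : V -> W) x u v :
  differentiable f x -> dder f (u + v) x = dder f u x + dder f v x.
Proof. by move=> df; rewrite -!dderE !deriveE// linearD. Qed.

Lemma dder_dirZ (W : normedModType R) (f : V -> W) x (a : R) u :
  differentiable f x -> dder f (a *: u) x = a *: dder f u x.
Proof. by move=> df; rewrite -!dderE !deriveE// linearZ. Qed.

Lemma dder_near (W : normedModType R) (f h : V -> W) x v :
  (\forall y \near x, f y = h y) -> dder f v x = dder h v x.
Proof. by rewrite -!dderE; exact: near_eq_derive. Qed.

Lemma dder_cst (W : normedModType R) (a : W) v x : dder (fun=> a) v x = 0.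
Proof. by rewrite -dderE derive_cst. Qed.

Lemma dderD (W : normedModType R) (f h : V -> W) x v :
  differentiable f x -> differentiable h x ->
  dder (fun y => f y + h y) v x = dder f v x + dder h v x.
Proof. by move=> df dh; rewrite -!dderE deriveD//; exact: diff_derivable. Qed.

Lemma dder_entry m n (M : V -> 'M[R]_(m, n)) x v i j :
  differentiable M x -> (dder M v x) i j = dder (fun y => M y i j : R) v x.
Proof. by move=> dM; rewrite -!dderE derive_entry. Qed.

Lemma dder_mulmx m n p (A : V -> 'M[R]_(m, n)) (B : V -> 'M[R]_(n, p)) x v :
  differentiable A x -> differentiable B x ->
  dder (fun y => A y *m B y) v x = dder A v x *m B x + A x *m dder B v x.
Proof. by move=> dA dB; rewrite -!dderE derive_mulmx. Qed.

Lemma dder_trmx m n (A : V -> 'M[R]_(m, n)) x v :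
  differentiable A x -> dder (fun y => (A y)^T) v x = (dder A v x)^T.
Proof. by move=> dA; rewrite -!dderE derive_trmx. Qed.

Lemma dderM (f h : V -> R) x v : differentiable f x -> differentiable h x ->
  dder (fun y => f y * h y) v x = dder f v x * h x + f x * dder h v x.
Proof.
move=> df dh; rewrite -!dderE deriveM; try exact: diff_derivable.
by rewrite addrC mulrC.
Qed.

Lemma differentiable_ip n (S : V -> 'M[R]_n) (X Y : V -> 'rV[R]_n) x :
  differentiable S x -> differentiable X x -> differentiable Y x ->
  differentiable (fun y => ip (S y) (X y) (Y y) : R) x.
Proof.
move=> dS dX dY.
have /differentiable_mxP := differentiable_mulmx
  (differentiable_mulmx dX dS) (differentiable_trmx dY).
exact.
Qed.

Lemma dder_ip n (S : V -> 'M[R]_n) (X Y : V -> 'rV[R]_n) x v :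
  differentiable S x -> differentiable X x -> differentiable Y x ->
  dder (fun y => ip (S y) (X y) (Y y) : R) v x =
  ip (dder S v x) (X x) (Y x) + ip (S x) (dder X v x) (Y x)
  + ip (S x) (X x) (dder Y v x).
Proof.
move=> dS dX dY.
have dXS := differentiable_mulmx dX dS.
have dYT := differentiable_trmx dY.
rewrite -(dder_entry v 0 0 (differentiable_mulmx dXS dYT)).
rewrite dder_mulmx// dder_mulmx// dder_trmx// /ip mulmxDl !mxE.
by rewrite [X in X + _ = _]addrC.
Qed.

End Derivations.

(** * Smooth maps on an open set *)

Section Smooth.
Variables (R : realType) (V : normedModType R) (U : set V).
Hypothesis openU : open U.

Lemma near_open x : U x -> \forall y \near x, U y.
Proof. by move=> Ux; apply: open_nbhs_nbhs. Qed.

Lemma Ck_congr (W : normedModType R) k (f h : V -> W) :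
  (forall x, U x -> f x = h x) -> Ck k U f -> Ck k U h.
Proof.
elim: k f h => [|k ih] f h fh /=.
  move=> cf x Ux; have := cf x Ux.
  rewrite /prop_for /continuous_at -fh// => cfx.
  apply: cvg_trans cfx; apply: near_eq_cvg.
  by near=> y; apply/fh; near: y; exact: near_open.
move=> [df ddf]; split=> [x Ux|v].
  apply: near_differentiable (df x Ux).
  by near=> y; apply: fh; near: y; exact: near_open.
apply: ih (ddf v) => x Ux; apply: near_eq_derive.
by near=> y; apply: fh; near: y; exact: near_open.
Unshelve. all: by end_near. Qed.

Lemma smooth_differentiable (W : normedModType R) (f : V -> W) x :
  smooth_on U f -> U x -> differentiable f x.
Proof. by move=> sf; exact: (sf 1).1. Qed.

Lemma smooth_derive (W : normedModType R) (f : V -> W) v :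
  smooth_on U f -> smooth_on U ('D_v f).
Proof. by move=> sf k; exact: (sf k.+1).2. Qed.

Lemma smooth_entry m n (f : V -> 'M[R]_(m, n)) i j :
  smooth_on U f -> smooth_on U (fun x => f x i j : R).
Proof.
move=> sf k; elim: k f sf => [|k ih] f sf /=.
  move=> x Ux; apply: differentiable_continuous.
  exact: (differentiable_mxP _ _).1 (smooth_differentiable sf Ux) i j.
split=> [x Ux|v].
  exact: (differentiable_mxP _ _).1 (smooth_differentiable sf Ux) i j.
apply: (Ck_congr _ (ih _ (smooth_derive v sf))) => x Ux.
by rewrite derive_entry//; exact: smooth_differentiable.
Qed.

Lemma smooth_derive_comm (f : V -> R) u v x :
  smooth_on U f -> U x -> 'D_u ('D_v f) x = 'D_v ('D_u f) x.
Proof.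
move=> sf Ux; apply: derive_sym.
- by near=> y; apply: smooth_differentiable sf _; near: y; exact: near_open.
- near=> y; apply: smooth_differentiable (smooth_derive u sf) _.
  by near: y; exact: near_open.
- near=> y; apply: smooth_differentiable (smooth_derive v sf) _.
  by near: y; exact: near_open.
- exact: (smooth_derive v (smooth_derive u sf) 0).
- exact: (smooth_derive u (smooth_derive v sf) 0).
Unshelve. all: by end_near. Qed.

Lemma smooth_derive_mx_comm m n (f : V -> 'M[R]_(m, n)) u v x :
  smooth_on U f -> U x -> 'D_u ('D_v f) x = 'D_v ('D_u f) x.
Proof.
move=> sf Ux; apply/matrixP => i j.
have E a b : ('D_a ('D_b f) x) i j = 'D_a ('D_b (fun y => f y i j : R)) x.
  rewrite derive_entry; last first.
    exact: smooth_differentiable (smooth_derive _ sf) Ux.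
  apply: near_eq_derive; near=> y; rewrite derive_entry//.
  by apply: smooth_differentiable => //; near: y; exact: near_open.
have sym := smooth_derive_comm u v (smooth_entry i j sf) Ux.
exact: (etrans (E u v) (etrans sym (esym (E v u)))).
Unshelve. all: by end_near. Qed.

Lemma smooth_dder (W : normedModType R) (f : V -> W) v :
  smooth_on U f -> smooth_on U (dder f v).
Proof.
rewrite (_ : dder f v = 'D_v f); first exact: smooth_derive.
by apply/funext => x; rewrite dderE.
Qed.

Lemma dder_comm m n (f : V -> 'M[R]_(m, n)) u v x :
  smooth_on U f -> U x -> dder (dder f v) u x = dder (dder f u) v x.
Proof.
have E a b : dder (dder f b) a x = 'D_a ('D_b f) x.
  by rewrite dderE; congr (dder _ a x); apply/funext => y; rewrite dderE.
by move=> sf Ux; rewrite (E u v) (E v u); exact: smooth_derive_mx_comm.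
Qed.

End Smooth.

(** * Bilinear forms given by a matrix *)

Section InnerProduct.
Variables (R : realType) (n : nat).
Implicit Types (S : 'M[R]_n) (u v w : 'rV[R]_n).

Lemma ipE S u v : ip S u v = (u *m S *m v^T) 0 0.
Proof. by []. Qed.

Lemma ip_linearr S u : linear (fun v => ip S u v : R^o).
Proof. by move=> a v w; rewrite /ip linearP/= mulmxDr -scalemxAr !mxE. Qed.

Lemma ipDl S u v w : ip S (u + v) w = ip S u w + ip S v w.
Proof. by rewrite /ip !mulmxDl !mxE. Qed.

Lemma ipDr S u v w : ip S w (u + v) = ip S w u + ip S w v.
Proof. by rewrite /ip linearD mulmxDr !mxE. Qed.

Lemma ipZl S a u w : ip S (a *: u) w = a * ip S u w.
Proof. by rewrite /ip -!scalemxAl !mxE. Qed.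

Lemma ipZr S a u w : ip S w (a *: u) = a * ip S w u.
Proof. by rewrite /ip linearZ/= -scalemxAr !mxE. Qed.

Lemma ipNl S u w : ip S (- u) w = - ip S u w.
Proof. by rewrite -scaleN1r ipZl mulN1r. Qed.

Lemma ipNr S u w : ip S w (- u) = - ip S w u.
Proof. by rewrite -scaleN1r ipZr mulN1r. Qed.

Lemma ipBl S u v w : ip S (u - v) w = ip S u w - ip S v w.
Proof. by rewrite ipDl ipNl. Qed.

Lemma ipBr S u v w : ip S w (u - v) = ip S w u - ip S w v.
Proof. by rewrite ipDr ipNr. Qed.

Lemma ip0l S w : ip S 0 w = 0.
Proof. by rewrite /ip !mul0mx mxE. Qed.

Lemma ip0r S w : ip S w 0 = 0.
Proof. by rewrite /ip trmx0 mulmx0 mxE. Qed.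

Lemma ipDm S T u v : ip (S + T) u v = ip S u v + ip T u v.
Proof. by rewrite /ip mulmxDr mulmxDl mxE. Qed.

Lemma ipZm a S u v : ip (a *: S) u v = a * ip S u v.
Proof. by rewrite /ip -scalemxAr -scalemxAl mxE. Qed.

Lemma ip_trmx S u v : ip S^T u v = ip S v u.
Proof.
rewrite /ip -[LHS](mxE trmx_key (fun i j => (u *m S^T *m v^T) j i)) -/(trmx _).
by rewrite !trmx_mul !trmxK mulmxA.
Qed.

Lemma ip_sym S u v : S^T = S -> ip S u v = ip S v u.
Proof. by move=> SE; rewrite -{1}SE ip_trmx. Qed.

Lemma ip_delta S u k : ip S u (delta_mx 0 k) = (u *m S) 0 k.
Proof.
rewrite /ip mxE (bigD1 k)//= big1 ?addr0 => [|j jk]; rewrite !mxE !eqxx/=.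
  by rewrite mulr1.
by rewrite (negbTE jk) mulr0.
Qed.

Lemma ip_inj S u v : S \in unitmx -> (forall w, ip S u w = ip S v w) -> u = v.
Proof.
move=> uS h; apply: (can_inj (mulmxK uS)); apply/rowP => k.
by rewrite -!ip_delta.
Qed.

Lemma posdef_unitmx S : (forall u, u != 0 -> 0 < ip S u u) -> S \in unitmx.
Proof.
move=> pos; rewrite -row_free_unit -kermx_eq0; apply/rowV0P => u /sub_kermxP uS.
by apply/eqP/negPn/negP => /pos; rewrite /ip uS mul0mx mxE ltxx.
Qed.

(** The hypothesis is a bare proof of [linear], so that expressions such as Koszul's formula can be
    expanded on the basis without a declared linear structure. *)
Lemma linear_delta (W : lmodType R) (f : 'rV[R]_n -> W) w : linear f ->
  f w = \sum_(k < n) w 0 k *: f (delta_mx 0 k).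
Proof.
move=> lf; pose fL := GRing.isLinear.Build _ _ _ _ _ lf.
pose F : {linear _ -> _} := HB.pack f fL.
have FE : F =1 f by [].
rewrite -FE {1}[w]row_sum_delta linear_sum; apply: eq_bigr => k _.
by rewrite linearZ.
Qed.

End InnerProduct.

Section Koszul.
Variables (R : realType) (n : nat) (g : 'rV[R]_n -> 'M[R]_n) (x : 'rV[R]_n).
Hypothesis dg : differentiable g x.

Lemma dder_ip_cst u v w :
  dder (fun y => ip (g y) u v : R) w x = ip (dder g w x) u v.
Proof.
rewrite (@dder_ip _ _ _ g (cst u) (cst v))//.
by rewrite !dder_cst ip0l ip0r !addr0.
Qed.

Lemma koszul_dder u v w : koszul g x u v w =
  2^-1 * (ip (dder g u x) v w + ip (dder g v x) u w - ip (dder g w x) u v).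
Proof. by rewrite /koszul !dderE !dder_ip_cst. Qed.

(** By definition the identity holds on the basis vectors; both sides are linear in [w], the right
    one because a derivative is linear in its direction. *)
Lemma ip_gam u v w : g x \in unitmx -> ip (g x) (gam g x u v) w = koszul g x u v w.
Proof.
move=> ug; rewrite (linear_delta w (f := fun w => koszul g x u v w : R^o)).
  rewrite unlock /christoffel ipE mulmxKV// mxE.
  by apply: eq_bigr => k _; rewrite !mxE mulrC.
move=> a w1 w2; rewrite /= !koszul_dder dder_dirD// dder_dirZ//.
by rewrite !(ipDr, ipZr, ipDm, ipZm) -[a *: _]/(a * _); ring.
Qed.

End Koszul.

Section Chart.
Variables (R : realType) (n : nat) (U : set 'rV[R]_n).
Variable g : 'rV[R]_n -> 'M[R]_n.
Hypotheses (openU : open U) (g_smooth : smooth_on U g).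
Hypothesis g_sym : forall x, U x -> (g x)^T = g x.
Hypothesis g_pos : forall x u, U x -> u != 0 -> 0 < ip (g x) u u.
Implicit Types (x y u v w : 'rV[R]_n).

Let nearU x : U x -> \forall y \near x, U y.
Proof. exact: (@near_open R _ U openU). Qed.

Lemma metric_differentiable x : U x -> differentiable g x.
Proof. exact: smooth_differentiable. Qed.

Lemma metric_unitmx x : U x -> g x \in unitmx.
Proof. by move=> Ux; apply: posdef_unitmx => u; exact: g_pos. Qed.

Lemma dder_metric_sym x w : U x -> (dder g w x)^T = dder g w x.
Proof.
move=> Ux; rewrite -dder_trmx; last exact: metric_differentiable.
apply: dder_near; near=> y; apply: g_sym; near: y; exact: nearU.
Unshelve. all: by end_near. Qed.

Lemma dder_metric_cst x u v w : U x ->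
  dder (fun y => ip (g y) u v : R) w x = ip (dder g w x) u v.
Proof. by move=> Ux; rewrite (dder_ip_cst (metric_differentiable Ux)). Qed.

Lemma koszulE x u v w : U x -> koszul g x u v w =
  2^-1 * (ip (dder g u x) v w + ip (dder g v x) u w - ip (dder g w x) u v).
Proof. by move=> Ux; rewrite (koszul_dder (metric_differentiable Ux)). Qed.

Lemma ip_christoffel x u v w : U x -> ip (g x) (gam g x u v) w = koszul g x u v w.
Proof.
by move=> Ux; rewrite (ip_gam (metric_differentiable Ux))//; exact: metric_unitmx.
Qed.

Lemma metric_inj x u v : U x ->
  (forall w, ip (g x) u w = ip (g x) v w) -> u = v.
Proof. by move=> Ux; apply: ip_inj; exact: metric_unitmx. Qed.

(** Absence of torsion: Koszul's formula for commuting fields is symmetric in its first two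
    arguments. *)
Lemma christoffelC x u v : U x -> gam g x u v = gam g x v u.
Proof.
move=> Ux; apply: (metric_inj Ux) => w; rewrite !ip_christoffel// !koszulE//.
by rewrite (ip_sym u v (dder_metric_sym w Ux)); ring.
Qed.

Lemma christoffel_linear x u : U x -> linear (gam g x u).
Proof.
move=> Ux a v w; apply: (metric_inj Ux) => z.
have dg := metric_differentiable Ux.
rewrite ipDl ipZl !ip_christoffel// !koszulE// dder_dirD// dder_dirZ//.
by rewrite ?(ipDr, ipDl, ipZl, ipZr, ipDm, ipZm); ring.
Qed.

(** The Christoffel map in the direction [u], as a matrix acting on row vectors from the right;
    composites are products in reverse order. *)
Definition chr u x : 'M[R]_n := \matrix_(i < n) gam g x u (delta_mx 0 i).

Lemma chrE x u v : U x -> gam g x u v = v *m chr u x.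
Proof.
move=> Ux; rewrite (linear_delta v (christoffel_linear u Ux)) mulmx_sum_row.
by apply: eq_bigr => k _; rewrite rowK.
Qed.

(** In the sum of the two Koszul expressions the derivatives of [g] along [u] and [v] cancel, and
    those along [w] add up. *)
Lemma metric_compat x u v w : U x ->
  ip (dder g w x) u v = ip (g x) (gam g x w u) v + ip (g x) u (gam g x w v).
Proof.
move=> Ux; rewrite (ip_sym u (gam g x w v) (g_sym Ux)) !ip_christoffel// !koszulE//.
rewrite (ip_sym v u (dder_metric_sym w Ux)).
by field.
Qed.

Lemma koszul_differentiable x u v w : U x ->
  differentiable (fun y => koszul g y u v w : R) x.
Proof.
move=> Ux; pose dg a b c y : R := ip (dder g a y) b c.
have ddg a b c : differentiable (dg a b c) x.
  apply: differentiable_ip; try exact: differentiable_cst.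
  exact: smooth_differentiable (smooth_dder a g_smooth) Ux.
apply: (@near_differentiable _ _ _
   (fun y => 2^-1 *: (dg u v w y + dg v u w y - dg w u v y))).
  by near=> y; rewrite koszulE//; near: y; exact: nearU.
apply: differentiableZ; apply: differentiableB => //.
exact: differentiableD.
Unshelve. all: by end_near. Qed.

Lemma christoffel_differentiable x u v : U x -> differentiable (fun y => gam g y u v) x.
Proof.
move=> Ux; rewrite (_ : (fun _ => _) = fun y => christoffel g y u v); last first.
  by apply/funext => y; rewrite unlock.
apply: differentiable_mulmx.
  apply/differentiable_mxP => i j.
  rewrite (_ : (fun _ => _) = fun y => koszul g y u v (delta_mx 0 j)).
    exact: koszul_differentiable.
  by apply/funext => y; rewrite mxE.
apply: differentiable_invmx; first exact: metric_differentiable.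
by near=> y; apply: metric_unitmx; near: y; exact: nearU.
Unshelve. all: by end_near. Qed.

Lemma chr_differentiable x u : U x -> differentiable (chr u) x.
Proof.
move=> Ux; apply/differentiable_mxP => i j.
rewrite (_ : (fun _ => _) = fun y => gam g y u (delta_mx 0 i) 0 j).
  exact: (differentiable_mxP _ _).1 (christoffel_differentiable u _ Ux) 0 j.
by apply/funext => y; rewrite mxE.
Qed.

End Chart.

(** * Curvature *)

(** Additivity passes from the third slot to the others through [F34] and pair symmetry. Polarizing
    [F0] then makes [F] alternating in the middle slots, hence in all, and the three terms of the
    Bianchi sum become equal. *)
Lemma curvature_like_eq0 (R : realFieldType) (V : lmodType R)
    (F : V -> V -> V -> V -> R)
    (F12 : forall u v w z, F v u w z = - F u v w z)
    (F34 : forall u v w z, F u v z w = - F u v w z)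
    (bianchi : forall u v w z, F u v w z + F v w u z + F w u v z = 0)
    (F3D : forall u v w w' z, F u v (w + w') z = F u v w z + F u v w' z)
    (F0 : forall u v, F u v v u = 0) :
  forall u v w z, F u v w z = 0.
Proof.
have F4D u v w z z' : F u v w (z + z') = F u v w z + F u v w z'.
  by rewrite !(F34 u v _ w) F3D opprD.
(* The octahedron argument: a linear combination of four Bianchi identities, one for each cyclic
   shift of the arguments. *)
have Fpair u v w z : F u v w z = F w z u v.
  have := bianchi u v w z; have := bianchi v w z u.
  have := bianchi w z u v; have := bianchi z u v w.
  rewrite (F34 z u v w) (F34 u v w z) (F34 w z u v) (F34 v w u z).
  rewrite (F12 v z w u) (F34 v z u w) (F12 u w v z) (F34 u w z v) => *; lra.
have F23 u v z : F u v v z = 0.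
  have := F0 (u + z) v; rewrite F4D !(Fpair (u + z)) !F3D -!(Fpair _ _ v).
  by rewrite !F0 (Fpair z v) (F12 u v z) (F34 _ _ v z); lra.
have F23N u v w z : F u w v z = - F u v w z.
  have := F23 u (v + w) z; rewrite F3D !(Fpair u (v + w)) !F4D -!(Fpair u) !F23.
  by lra.
move=> u v w z; have := bianchi u v w z.
rewrite (F23N v u w) (F12 u v) (F12 u w) (F23N u v w); lra.
Qed.

(** A relation [r *: u + t *: v = 0], paired with [u] and with [v], is a linear system in [r] and
    [t] whose determinant is the Gram determinant. *)
Lemma gram_row_free (R : realType) n (S : 'M[R]_n) (u v : 'rV[R]_n) : S^T = S ->
  ip S u u * ip S v v - ip S u v ^+ 2 != 0 -> row_free (col_mx u v).
Proof.
move=> Ssym D0; rewrite -kermx_eq0; apply/rowV0P => c /sub_kermxP.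
rewrite -[c](@hsubmxK _ 1 1 1) mul_row_col.
rewrite [lsubmx c]mx11_scalar [rsubmx c]mx11_scalar !mul_scalar_mx.
set r := lsubmx c 0 0; set t := rsubmx c 0 0 => rt.
have ru : r * ip S u u + t * ip S u v = 0 by rewrite -!ipZr -ipDr rt ip0r.
have rv : r * ip S u v + t * ip S v v = 0.
  by rewrite (ip_sym u v Ssym) -!ipZr -ipDr rt ip0r.
have r0 : r = 0.
  apply: (mulIf D0); transitivity (ip S v v * (r * ip S u u + t * ip S u v)
      - ip S u v * (r * ip S u v + t * ip S v v)); first by ring.
  by rewrite ru rv !mulr0 subrr mul0r.
have t0 : t = 0.
  apply: (mulIf D0); transitivity (ip S u u * (r * ip S u v + t * ip S v v)
      - ip S u v * (r * ip S u u + t * ip S u v)); first by ring.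
  by rewrite ru rv !mulr0 subrr mul0r.
by rewrite r0 t0 !raddf0 row_mx0.
Qed.

Section Curvature.
Variables (R : realType) (n : nat) (U : set 'rV[R]_n).
Variable g : 'rV[R]_n -> 'M[R]_n.
Hypotheses (openU : open U) (g_smooth : smooth_on U g).
Hypothesis g_sym : forall x, U x -> (g x)^T = g x.
Hypothesis g_pos : forall x u, U x -> u != 0 -> 0 < ip (g x) u u.
Implicit Types (x y u v w : 'rV[R]_n).

Let nearU x : U x -> \forall y \near x, U y.
Proof. exact: (@near_open R _ U openU). Qed.

(** The direction [u] is a constant field, so [cov X u] is again a field on the chart and second
    covariant derivatives are plain iterates. *)
Definition cov (X : 'rV[R]_n -> 'rV[R]_n) u x : 'rV[R]_n :=
  dder X u x + X x *m chr g u x.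

Lemma nablaE X Y x : U x -> nabla g X Y x = cov Y (X x) x.
Proof.
move=> Ux; rewrite /nabla /cov dderE -(chrE g_smooth g_pos)//.
by congr (_ + _); rewrite gam.unlock.
Qed.

Let chr_diff x u : U x -> differentiable (chr g u) x.
Proof. exact: chr_differentiable. Qed.

Lemma cov_differentiable X u x : smooth_on U X -> U x -> differentiable (cov X u) x.
Proof.
move=> sX Ux; apply: differentiableD.
  exact: (smooth_differentiable (smooth_dder u sX)).
by apply: differentiable_mulmx; [exact: smooth_differentiable sX Ux|exact: chr_diff].
Qed.

Lemma cov_compat X Y x u : U x -> differentiable X x -> differentiable Y x ->
  dder (fun y => ip (g y) (X y) (Y y) : R) u x =
  ip (g x) (cov X u x) (Y x) + ip (g x) (X x) (cov Y u x).
Proof.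
move=> Ux dX dY; rewrite dder_ip//; last exact: smooth_differentiable g_smooth Ux.
rewrite (metric_compat openU g_smooth g_sym g_pos)// /cov !(chrE g_smooth g_pos)//.
by rewrite ipDl ipDr; ring.
Qed.

(** The operator R(u, v) acting on row vectors from the right, so that nabla_u nabla_v contributes
    [chr g v x *m chr g u x]. *)
Definition curv u v x : 'M[R]_n :=
  dder (chr g v) u x - dder (chr g u) v x + chr g v x *m chr g u x
  - chr g u x *m chr g v x.

(** Constant directions commute, so no bracket term occurs. The second derivatives of [X] cancel by
    symmetry, and the products of its first derivatives with Christoffel matrices occur in both
    expansions. *)
Lemma ricci_identity X x u v : smooth_on U X -> U x ->
  cov (cov X v) u x - cov (cov X u) v x = X x *m curv u v x.
Proof.
move=> sX Ux.
have E a b : cov (cov X b) a x = dder (dder X b) a x + dder X a x *m chr g b x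
   + X x *m dder (chr g b) a x + dder X b x *m chr g a x + X x *m (chr g b x *m chr g a x).
  have dX := smooth_differentiable sX Ux.
  rewrite /cov dderD; last 2 first.
    exact: (smooth_differentiable (smooth_dder b sX)).
    by apply: differentiable_mulmx => //; exact: chr_diff.
  rewrite dder_mulmx//; last exact: chr_diff.
  by rewrite mulmxDl mulmxA !addrA.
rewrite (E u v) (E v u) (dder_comm openU u v sX Ux) /curv.
rewrite !mulmxDr !mulmxN.
set a := dder (dder X u) v x; set b := dder X u x *m _; set c := X x *m _.
set d := dder X v x *m _; set e := X x *m _; set f := X x *m _; set h := X x *m _.
clearbody a b c d e f h.
by apply/rowP => k; rewrite !mxE; ring.
Qed.

Lemma chr_sym x u v : U x -> v *m chr g u x = u *m chr g v x.
Proof.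
move=> Ux; rewrite -!(chrE g_smooth g_pos)//.
exact: (christoffelC openU g_smooth g_sym g_pos).
Qed.

Lemma dder_chr_sym x a u v : U x ->
  v *m dder (chr g u) a x = u *m dder (chr g v) a x.
Proof.
move=> Ux; have E (b c : 'rV[R]_n) :
    c *m dder (chr g b) a x = dder (fun y => c *m chr g b y) a x.
  rewrite (@dder_mulmx _ _ _ _ _ (fun=> c) (chr g b))//; last exact: chr_diff.
  by rewrite dder_cst mul0mx add0r.
rewrite (E u v) (E v u); apply: dder_near.
by near=> y; apply: chr_sym; near: y; exact: nearU.
Unshelve. all: by end_near. Qed.

Lemma curvN x u v : curv v u x = - curv u v x.
Proof.
rewrite /curv; have key (a b c d : 'M[R]_n) : b - a + d - c = - (a - b + c - d).
  by apply/matrixP => i j; rewrite !mxE; ring.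
exact: key.
Qed.

(** Absence of torsion, together with its derivative, lets the twelve terms of the cyclic sum cancel
    in pairs. *)
Lemma curv_bianchi x u v w : U x ->
  w *m curv u v x + u *m curv v w x + v *m curv w u x = 0.
Proof.
move=> Ux; rewrite /curv !mulmxDr !mulmxN !mulmxA.
rewrite (dder_chr_sym u w v)// (dder_chr_sym v w u)// (dder_chr_sym w v u)//.
rewrite (chr_sym v w)// (chr_sym u w)// (chr_sym u v)//.
move: (w *m dder (chr g v) u x) (w *m dder (chr g u) v x) => a b.
move: (v *m dder (chr g u) w x) => c.
move: (v *m chr g w x *m _) (u *m chr g w x *m _) (u *m chr g v x *m _) => d e f.
by apply/rowP => k; rewrite !mxE; ring.
Qed.

Lemma smooth_cst (w : 'rV[R]_n) : smooth_on U (fun=> w).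
Proof.
move=> k; elim: k w => [|k ih] w /=; first by move=> x _; exact: cst_continuous.
split=> [x _|v]; first exact: differentiable_cst.
rewrite (_ : 'D_v _ = fun=> 0); first exact: ih.
by apply/funext => y; rewrite derive_cst.
Qed.

Lemma riemannE x u v w : U x -> riemann g x u v w = w *m curv u v x.
Proof.
move=> Ux; rewrite -(ricci_identity u v (smooth_cst w) Ux) /riemann.
rewrite (nablaE (fun=> u))// (nablaE (fun=> v))//.
have E a b : cov (nabla g (fun=> a) (fun=> w)) b x = cov (cov (fun=> w) a) b x.
  rewrite /cov nablaE//; congr (_ + _); apply: dder_near.
  by near=> y; rewrite nablaE//; near: y; exact: nearU.
by congr (_ - _); exact: E.
Unshelve. all: by end_near. Qed.

(** For constant [w], metric compatibility gives g(nabla_u nabla_v w, w) = (1/2) D_u D_v g(w, w) -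
    g(nabla_v w, nabla_u w), and the right side is symmetric in [u] and [v]. *)
Lemma curv_skew x u v w : U x -> ip (g x) (w *m curv u v x) w = 0.
Proof.
move=> Ux; rewrite -(ricci_identity u v (smooth_cst w) Ux) ipBl.
have E a b : ip (g x) (cov (cov (fun=> w) b) a x) w =
    2^-1 * ip (dder (dder g b) a x) w w
    - ip (g x) (cov (fun=> w) b x) (cov (fun=> w) a x).
  have dcw := cov_differentiable b (smooth_cst w) Ux.
  have := cov_compat a Ux dcw (differentiable_cst w x).
  rewrite (@dder_near _ _ _ _ (fun y => 2^-1 * ip (dder g b y) w w)); last first.
    near=> y; have Uy : U y by near: y; exact: nearU.
    rewrite (metric_compat openU g_smooth g_sym g_pos)//.
    rewrite (ip_sym w _ (g_sym Uy)) /cov dder_cst add0r !(chrE g_smooth g_pos)//.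
    by field.
  have ddg : differentiable (dder g b) x.
    exact: smooth_differentiable (smooth_dder b g_smooth) Ux.
  rewrite (@dderM _ _ (fun=> 2^-1))//; last first.
    by apply: differentiable_ip => //; exact: differentiable_cst.
  rewrite dder_cst mul0r add0r (@dder_ip _ _ _ (dder g b) (fun=> w) (fun=> w))//.
  by rewrite !dder_cst ip0l ip0r !addr0 => ->; rewrite addrK.
rewrite (E u v) (E v u) (dder_comm openU u v g_smooth Ux).
by rewrite (ip_sym _ (cov _ u x) (g_sym Ux)); ring.
Unshelve. all: by end_near. Qed.

Variable kappa : R.
Hypothesis g_curv : forall x u v, U x -> row_free (col_mx u v) ->
  sectional g x u v = kappa.

Lemma curv_skewr x u v w z : U x ->
  ip (g x) (z *m curv u v x) w = - ip (g x) (w *m curv u v x) z.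
Proof.
move=> Ux; have := curv_skew u v (w + z) Ux; rewrite mulmxDl !(ipDl, ipDr).
by rewrite !curv_skew//; lra.
Qed.

Lemma metric_eq0 x u : U x -> ip (g x) u u = 0 -> u = 0.
Proof. by move=> Ux u0; apply/eqP/negPn/negP => /(g_pos Ux); rewrite u0 ltxx. Qed.

(** The difference [F] of the two sides has the symmetries of a curvature tensor and no sectional
    part, so [curvature_like_eq0] applies. *)
Lemma curv_const x u v w z : U x -> ip (g x) (w *m curv u v x) z =
  kappa * (ip (g x) v w * ip (g x) u z - ip (g x) u w * ip (g x) v z).
Proof.
move=> Ux; apply/eqP; rewrite -subr_eq0; apply/eqP.
have gC a b := ip_sym a b (g_sym Ux).
pose F (u v w z : 'rV[R]_n) := ip (g x) (w *m curv u v x) z -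
  kappa * (ip (g x) v w * ip (g x) u z - ip (g x) u w * ip (g x) v z).
have F12 u' v' w' z' : F v' u' w' z' = - F u' v' w' z'.
  by rewrite /F curvN mulmxN ipNl; ring.
have F34 u' v' w' z' : F u' v' z' w' = - F u' v' w' z'.
  by rewrite /F curv_skewr//; ring.
have F3D u' v' w' w'' z' : F u' v' (w' + w'') z' = F u' v' w' z' + F u' v' w'' z'.
  by rewrite /F mulmxDl !ipDl !ipDr; ring.
have F3Z u' v' (a : R) w' z' : F u' v' (a *: w') z' = a * F u' v' w' z'.
  by rewrite /F -scalemxAl !ipZl !ipZr; ring.
have Fuu u' w' z' : F u' u' w' z' = 0 by have := F12 u' u' w' z'; lra.
have Fww u' v' w' : F u' v' w' w' = 0 by have := F34 u' v' w' w'; lra.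
apply: (curvature_like_eq0 F12 F34 _ F3D).
  move=> a b c d; rewrite /F.
  have := congr1 (fun y => ip (g x) y d) (curv_bianchi a b c Ux).
  rewrite ip0l !ipDl (gC b c) (gC a c) (gC a b); lra.
move=> a b.
(* The curvature hypothesis covers independent pairs. When the Gram determinant is zero, [b = 0] or
   [a] is a multiple of [b], and [F a b b a] vanishes by homogeneity or skew symmetry. *)
have [D0|D0] := eqVneq (ip (g x) a a * ip (g x) b b - ip (g x) a b ^+ 2) 0.
  (* The squared length of this vector is [ip (g x) b b] times the Gram determinant. *)
  have : ip (g x) b b *: a - ip (g x) a b *: b = 0.
    apply: (metric_eq0 Ux); rewrite ipBl !ipBr !(ipZl, ipZr) (gC b a).
    by rewrite -[RHS](mulr0 (ip (g x) b b)) -D0; ring.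
  move/eqP; rewrite subr_eq0 => /eqP ab.
  have [b0|b0] := eqVneq (ip (g x) b b) 0.
    have -> : b = 0 *: b by rewrite (metric_eq0 Ux b0) scaler0.
    by rewrite F3Z mul0r.
  have aE : a = (ip (g x) a b / ip (g x) b b) *: b.
    by rewrite mulrC -scalerA -ab scalerA mulVf// scale1r.
  by rewrite F34 {2}aE F3Z Fww mulr0 oppr0.
rewrite /F; have <- : sectional g x a b = kappa.
  by apply: g_curv => //; exact: gram_row_free (g_sym Ux) D0.
by rewrite /sectional riemannE// (gC b a) [ip _ b b * _]mulrC -expr2 divfK// subrr.
Qed.

End Curvature.

(** * The pointwise Bochner identity *)

Section Traces.
Variables (R : realType) (n : nat).
Implicit Types (S N L X T : 'M[R]_n).

Lemma gtrace_mxtrace S (b : 'rV[R]_n -> 'rV[R]_n -> R^o) (Q : 'M[R]_n) :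
  (forall i j, b (delta_mx 0 i) (delta_mx 0 j) = Q i j) ->
  gtrace S b = \tr (invmx S *m Q^T).
Proof.
move=> bQ; rewrite /gtrace /mxtrace; apply: eq_bigr => i _.
by rewrite mxE; apply: eq_bigr => j _; rewrite bQ !mxE.
Qed.

Lemma ip_delta_mul S (A B : 'M[R]_n) i j :
  ip S (delta_mx 0 i *m A) (delta_mx 0 j *m B) = (A *m S *m B^T) i j.
Proof.
rewrite ipE trmx_mul -(mulmxA _ A) -(mulmxA _ (A *m S)) (mulmxA (A *m S)).
rewrite trmx_delta; move: (A *m S *m B^T) => Q.
by rewrite -colE -rowE !mxE.
Qed.

Lemma mxtrace_mulmxtr_ge0 X : 0 <= \tr (X *m X^T).
Proof.
rewrite /mxtrace sumr_ge0// => i _; rewrite mxE sumr_ge0// => j _.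
by rewrite mxE -expr2 sqr_ge0.
Qed.

Lemma mxtrace_mulmxtr_eq0 X : \tr (X *m X^T) <= 0 -> X = 0.
Proof.
move=> X0; have : \tr (X *m X^T) == 0 by rewrite eq_le X0 mxtrace_mulmxtr_ge0.
rewrite /mxtrace psumr_eq0 => [/allP h|i _]; last first.
  by rewrite mxE sumr_ge0// => j _; rewrite mxE -expr2 sqr_ge0.
apply/matrixP => i j; rewrite mxE.
have := h i (mem_index_enum i); rewrite /= mxE psumr_eq0 => [/allP h'|k _]; last first.
  by rewrite mxE -expr2 sqr_ge0.
by have := h' j (mem_index_enum j); rewrite /= mxE mulf_eq0 orbb => /eqP.
Qed.

(** Gram-Schmidt, one vector at a time; the rows of [T] form the orthonormal family. *)
Lemma orthonormal_basis S : S^T = S -> (forall u, u != 0 -> 0 < ip S u u) ->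
  exists T, T *m S *m T^T = 1%:M.
Proof.
move=> Ssym Spos.
suff H k : (k <= n)%N -> exists T : 'M[R]_(k, n), T *m S *m T^T = 1%:M by exact: H.
elim: k => [|k ih] kn; first by exists 0; apply/matrixP => -[].
have [T TS] := ih (ltnW kn).
(* The rank of [T] is at most [k < n], so some basis vector lies outside its row space. *)
have : ~~ (1%:M <= T)%MS.
  apply/negP => /mxrankS; rewrite mxrank1 => /leq_trans/(_ (rank_leq_row T)).
  by rewrite leqNgt kn.
move=> /row_subPn[i]; set u := row i _ => uT.
pose w := u - u *m S *m T^T *m T.
have w0 : w != 0.
  by apply: contraNN uT; rewrite subr_eq0 => /eqP ->; exact: submxMl.
have wT : w *m S *m T^T = 0.
  rewrite /w !mulmxBl -!mulmxA (mulmxA T) TS mulmx1 subrr//.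
have Tw : T *m S *m w^T = 0.
  by apply: trmx_inj; rewrite !trmx_mul trmxK Ssym trmx0 mulmxA.
have c0 := Spos w w0; pose c := Num.sqrt (ip S w w).
have cu : c ^+ 2 = ip S w w by rewrite sqr_sqrtr// ltW.
have cn0 : c != 0 by rewrite -sqrf_eq0 cu gt_eqF.
pose T' : 'M[R]_(1 + k, n) := col_mx (c^-1 *: w) T.
suff : T' *m S *m T'^T = 1%:M by exists T'.
rewrite /T' mul_col_mx tr_col_mx mul_col_row TS linearZ/=.
rewrite -!scalemxAl -!scalemxAr wT Tw !scaler0.
rewrite [w *m S *m w^T]mx11_scalar -ipE -cu scalerA !scale_scalar_mx.
rewrite (@scalar_mx_block _ 1 k); congr block_mx; congr _%:M.
by field.
Qed.

Lemma orthonormal_invmx S T : T *m S *m T^T = 1%:M ->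
  S \in unitmx /\ invmx S = T^T *m T.
Proof.
move=> TS; have : (T^T *m T) *m S = 1%:M by rewrite -mulmxA; exact: mulmx1C.
move=> h; have [_ uS] := mulmx1_unit h; split=> //.
by rewrite -[RHS]mulmx1 -(mulmxV uS) mulmxA h mul1mx.
Qed.

(** In the orthonormal basis formed by the rows of [T], the endomorphism [N] has matrix [X], and the
    trace is the sum of the squared entries of [X]. *)
Lemma mxtrace_nabla_frobenius S N : S^T = S -> (forall u, u != 0 -> 0 < ip S u u) ->
  0 <= \tr (invmx S *m (N *m S *m N^T)) /\
  (\tr (invmx S *m (N *m S *m N^T)) <= 0 -> N = 0).
Proof.
move=> Ssym Spos; have [T TS] := orthonormal_basis Ssym Spos.
have [uS SE] := orthonormal_invmx TS.
have uT : T \in unitmx by move: TS; rewrite -mulmxA => /mulmx1_unit[].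
pose X := T *m N *m (S *m T^T).
have -> : invmx S *m (N *m S *m N^T) = T^T *m (T *m N *m S *m N^T).
  by rewrite SE !mulmxA.
rewrite mxtrace_mulC.
have -> : T *m N *m S *m N^T *m T^T = X *m X^T.
  rewrite /X !trmx_mul trmxK Ssym !mulmxA -[_ *m T^T *m T]mulmxA -SE.
  by rewrite -[_ *m invmx S]mulmxA mulmxV// mulmx1.
split=> [|/mxtrace_mulmxtr_eq0 X0]; first exact: mxtrace_mulmxtr_ge0.
have uST : S *m T^T \in unitmx by rewrite unitmx_mul uS unitmx_tr.
have : T *m N = 0 by rewrite -(mulmxK uST (T *m N)) -/X X0 mul0mx.
by move=> TN; rewrite -(mulKmx uT N) TN mulmx0.
Qed.

(** Here [L] is a bilinear form, so its matrix in the orthonormal basis is [T *m L *m T^T]; the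
    trace is again a sum of squares. *)
Lemma mxtrace_lie_frobenius S L : S^T = S -> (forall u, u != 0 -> 0 < ip S u u) ->
  0 <= \tr (invmx S *m (L *m invmx S *m L^T)) /\
  (\tr (invmx S *m (L *m invmx S *m L^T)) <= 0 -> L = 0).
Proof.
move=> Ssym Spos; have [T TS] := orthonormal_basis Ssym Spos.
have [uS SE] := orthonormal_invmx TS.
have uT : T \in unitmx by move: TS; rewrite -mulmxA => /mulmx1_unit[].
pose X := T *m L *m T^T.
have -> : \tr (invmx S *m (L *m invmx S *m L^T)) = \tr (X *m X^T).
  by rewrite SE -(mulmxA T^T T) mxtrace_mulC /X !trmx_mul trmxK !mulmxA.
split=> [|/mxtrace_mulmxtr_eq0 X0]; first exact: mxtrace_mulmxtr_ge0.
have uTT : T^T \in unitmx by rewrite unitmx_tr.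
have : T *m L = 0 by rewrite -(mulmxK uTT (T *m L)) -/X X0 mul0mx.
by move=> TL; rewrite -(mulKmx uT L) TL mulmx0.
Qed.

Lemma mxtrace_lie S N : S \in unitmx -> S^T = S -> let L := N *m S + S *m N^T in
  \tr (invmx S *m (L *m invmx S *m L^T)) =
  2 * \tr (invmx S *m (N *m S *m N^T)) + 2 * \tr (N *m N).
Proof.
move=> uS Ssym L.
have Lsym : L^T = L by rewrite linearD/= !trmx_mul trmxK Ssym addrC.
(* [P] is conjugate to [N]. The square of [P + N^T] contributes the trace of [N *m N] twice, and two
   equal cross terms that give the norm of [N]. *)
pose P := invmx S *m N *m S.
have SL : invmx S *m L = P + N^T by rewrite mulmxDr !mulmxA mulVmx// mul1mx.
have PP : \tr (P *m P) = \tr (N *m N).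
  rewrite /P -!mulmxA (mulmxA S (invmx S)) mulmxV// mul1mx mxtrace_mulC.
  by rewrite -!mulmxA mulmxV// mulmx1.
have NN : \tr (N^T *m N^T) = \tr (N *m N) by rewrite -trmx_mul mxtrace_tr.
rewrite Lsym -(mulmxA L) (mulmxA (invmx S) L) SL mulmxDl !mulmxDr !mxtraceD PP NN.
rewrite (mxtrace_mulC N^T) /P !mulmxA; ring.
Qed.

End Traces.

(** * The covariant derivative of a field, its norms and the trace of its square *)

Section Bochner.
Variables (R : realType) (n : nat) (U : set 'rV[R]_n).
Variable g : 'rV[R]_n -> 'M[R]_n.
Hypotheses (openU : open U) (g_smooth : smooth_on U g).
Hypothesis g_sym : forall x, U x -> (g x)^T = g x.
Hypothesis g_pos : forall x u, U x -> u != 0 -> 0 < ip (g x) u u.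
Variable s : 'rV[R]_n -> 'rV[R]_n.
Hypothesis s_smooth : smooth_on U s.
Implicit Types (x y u v w : 'rV[R]_n).

Let nearU x : U x -> \forall y \near x, U y.
Proof. exact: (@near_open R _ U openU). Qed.

Definition cov_mx x : 'M[R]_n := \matrix_(i < n) cov g s (delta_mx 0 i) x.

(** The direction sits inside the Christoffel matrix; symmetry of the Christoffel map moves it
    outside, where linearity is visible. *)
Lemma cov_linear x : U x -> linear (fun u => cov g s u x).
Proof.
move=> Ux a u v; rewrite /cov !(chr_sym openU g_smooth g_sym g_pos _ (s x))//.
have ds := smooth_differentiable s_smooth Ux.
by rewrite dder_dirD// dder_dirZ// mulmxDl -scalemxAl scalerDr addrACA.
Qed.

Lemma cov_mxE x u : U x -> cov g s u x = u *m cov_mx x.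
Proof.
move=> Ux; rewrite (linear_delta u (cov_linear Ux)) mulmx_sum_row.
by apply: eq_bigr => k _; rewrite rowK.
Qed.

Lemma cov_mx_differentiable x : U x -> differentiable cov_mx x.
Proof.
move=> Ux; apply/differentiable_mxP => i j.
rewrite (_ : (fun _ => _) = fun y => cov g s (delta_mx 0 i) y 0 j).
  have := cov_differentiable openU g_smooth g_pos (delta_mx 0 i) s_smooth Ux.
  by move/differentiable_mxP; exact.
by apply/funext => y; rewrite mxE.
Qed.

Lemma divergenceE x : U x -> divergence g s x = \tr (cov_mx x).
Proof.
by move=> Ux; apply: eq_bigr => i _; rewrite [RHS]mxE (nablaE g_smooth g_pos).
Qed.

Lemma normsq_nablaE x : U x ->
  normsq_nabla g s x = \tr (invmx (g x) *m (cov_mx x *m g x *m (cov_mx x)^T)).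
Proof.
move=> Ux; rewrite /normsq_nabla.
rewrite (@gtrace_mxtrace _ _ _ _ (cov_mx x *m g x *m (cov_mx x)^T)).
  by rewrite !trmx_mul trmxK (g_sym Ux) !mulmxA.
by move=> i j; rewrite !(nablaE g_smooth g_pos)// !cov_mxE// ip_delta_mul.
Qed.

(** Metric compatibility turns the derivative of [g] along [s] into Christoffel terms, which by
    symmetry complete the derivatives of [s] to covariant ones. *)
Lemma lie_metricE x u v : U x ->
  lie_metric g s x u v = ip (g x) (u *m cov_mx x) v + ip (g x) u (v *m cov_mx x).
Proof.
move=> Ux; rewrite /lie_metric !dderE (dder_metric_cst g_smooth)//.
rewrite (metric_compat openU g_smooth g_sym g_pos)// -!cov_mxE// /cov.
rewrite -!(chrE g_smooth g_pos)// !(christoffelC openU g_smooth g_sym g_pos (s x) _ Ux).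
by rewrite ipDl ipDr; ring.
Qed.

Definition lie_mx x := cov_mx x *m g x + g x *m (cov_mx x)^T.

Lemma lie_metric_mx x u v : U x -> lie_metric g s x u v = ip (lie_mx x) u v.
Proof.
by move=> Ux; rewrite lie_metricE// /lie_mx ipDm !ipE trmx_mul !mulmxA.
Qed.

Lemma normsq_lieE x : U x -> normsq_lie g s x =
  \tr (invmx (g x) *m (lie_mx x *m invmx (g x) *m (lie_mx x)^T)).
Proof.
move=> Ux; have gV : (invmx (g x))^T = invmx (g x) by rewrite trmx_inv g_sym.
have LE i j : lie_metric g s x (delta_mx 0 i) (delta_mx 0 j) = lie_mx x i j.
  by rewrite lie_metric_mx// ip_delta -rowE mxE.
move: (lie_mx x) LE => L LE.
rewrite /normsq_lie (@gtrace_mxtrace _ _ _ _ (L *m invmx (g x) *m L^T)).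
  by rewrite !trmx_mul trmxK gV !mulmxA.
move=> i j; rewrite /gtrace [RHS]mxE exchange_big/=; apply: eq_bigr => k _.
rewrite !mxE big_distrl/=; apply: eq_bigr => l _.
by rewrite !LE -[LHS]/(_ * (_ * _)); ring.
Qed.

Lemma normsq_lie_nabla x : U x -> normsq_lie g s x =
  2 * normsq_nabla g s x + 2 * \tr (cov_mx x *m cov_mx x).
Proof.
move=> Ux; rewrite normsq_lieE// normsq_nablaE// mxtrace_lie ?g_sym//.
exact: (metric_unitmx g_pos).
Qed.

Variable kappa : R.
Hypothesis g_curv : forall x u v, U x -> row_free (col_mx u v) ->
  sectional g x u v = kappa.

Lemma curv_mxE x u v w : U x ->
  w *m curv g u v x = kappa *: (ip (g x) v w *: u - ip (g x) u w *: v).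
Proof.
move=> Ux; apply: (metric_inj g_pos Ux) => z.
by rewrite (curv_const openU g_smooth g_sym g_pos g_curv)// ipZl ipBl !ipZl.
Qed.

Hypothesis s_geodesic : forall x, U x -> cov g s (s x) x = 0.
Hypothesis s_div : forall x, U x -> divergence g s x = 0.

Lemma bochner x : U x ->
  \tr (cov_mx x *m cov_mx x) + (n%:R - 1) * kappa * ip (g x) (s x) (s x) = 0.
Proof.
move=> Ux; set N := cov_mx x; set t := s x.
pose J := \matrix_(i < n) dder s (delta_mx 0 i) x.
(* By symmetry of the Christoffel map, [N] differs from the Jacobian of [s] by a single Christoffel
   matrix. *)
have NE : N = J + chr g t x.
  apply/row_matrixP => i; rewrite linearD/= !rowK /cov; congr (_ + _).
  by rewrite (chr_sym openU g_smooth g_sym g_pos)// -(chrE g_smooth g_pos).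
have sN : t *m N = 0 by rewrite -cov_mxE// s_geodesic.
have dN := cov_mx_differentiable Ux.
(* The derivative along the i-th coordinate of the identity s N = 0, which holds near [x]. *)
have JN i : dder s (delta_mx 0 i) x *m N + t *m dder cov_mx (delta_mx 0 i) x = 0.
  rewrite /N /t -(@dder_mulmx _ _ _ _ _ s cov_mx)//; last first.
    exact: smooth_differentiable s_smooth Ux.
  rewrite -[RHS](dder_cst (0 : 'rV[R]_n) (delta_mx 0 i) x); apply: dder_near.
  near=> y; have Uy : U y by near: y; exact: nearU.
  by rewrite -cov_mxE// s_geodesic.
have dcov u v : dder (cov g s u) v x = u *m dder cov_mx v x.
  rewrite (@dder_near _ _ _ _ (fun y => u *m cov_mx y)).
    by rewrite (@dder_mulmx _ _ _ _ _ (fun=> u) cov_mx)// dder_cst mul0mx add0r.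
  by near=> y; rewrite cov_mxE//; near: y; exact: nearU.
(* The Ricci identity with one direction frozen at the value [t] of [s] at [x]; the Christoffel term
   carrying [cov g s t x] vanishes at that point. *)
have tN i : t *m dder cov_mx (delta_mx 0 i) x =
    delta_mx 0 i *m (dder cov_mx t x + N *m chr g t x) + t *m curv g (delta_mx 0 i) t x.
  rewrite -(ricci_identity openU g_smooth g_pos _ _ s_smooth Ux).
  rewrite mulmxDr -!dcov mulmxA -cov_mxE// addrC /(cov _ (cov _ _ _) t x) subrK.
  have covE X u : cov g X u x = dder X u x + X x *m chr g u x by [].
  by rewrite [RHS]covE s_geodesic// mul0mx addr0.
have trdN : \tr (dder cov_mx t x) = 0.
  rewrite -[RHS](dder_cst (0 : R) t x) -(@dder_near _ _ _ (fun y => \tr (cov_mx y))).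
    rewrite /mxtrace -[RHS]dderE.
    rewrite (_ : (fun y => _) = \sum_(i < n) (fun y => cov_mx y i i : R)).
      rewrite derive_sum => [|i]; last first.
        by apply: diff_derivable; have /differentiable_mxP := dN; exact.
      by apply: eq_bigr => i _; rewrite dder_entry// dderE.
    by apply/funext => y; rewrite fct_sumE.
  by near=> y; rewrite -divergenceE ?s_div//; near: y; exact: nearU.
(* The i-th coordinate of the i-th identity, summed over i, produces the traces. *)
have tr0 : \tr (J *m N + (dder cov_mx t x + N *m chr g t x)) +
    \sum_(i < n) (t *m curv g (delta_mx 0 i) t x) 0 i = 0.
  rewrite /mxtrace -big_split/=; apply: big1 => i _.
  have := JN i; rewrite tN.
  have -> : dder s (delta_mx 0 i) x *m N = delta_mx 0 i *m (J *m N).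
    by rewrite mulmxA -rowE rowK.
  rewrite addrA -mulmxDr -rowE => /(congr1 (fun m : 'rV[R]_n => m 0 i)).
  by rewrite 2!mxE [X in X + _]mxE [RHS]mxE.
(* This is the Ricci curvature of [t]; the -1 comes from the component along [t] itself. *)
have curv_tr : \sum_(i < n) (t *m curv g (delta_mx 0 i) t x) 0 i =
    (n%:R - 1) * kappa * ip (g x) t t.
  transitivity (\sum_(i < n) (kappa * ip (g x) t t
      - kappa * (t 0 i * ip (g x) t (delta_mx 0 i)))).
    apply: eq_bigr => i _; rewrite curv_mxE// !mxE !eqxx/= mulr1.
    by rewrite (ip_sym t _ (g_sym Ux)); ring.
  rewrite sumrB sumr_const card_ord -mulr_sumr.
  rewrite -(linear_delta (W := R^o) (f := fun v => ip (g x) t v) t (ip_linearr (g x) t)).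
  by rewrite -mulr_natl; ring.
have -> : \tr (N *m N) = \tr (J *m N) + \tr (N *m chr g t x).
  by rewrite {1}NE mulmxDl mxtraceD (mxtrace_mulC (chr g t x)).
by move: tr0; rewrite curv_tr !mxtraceD trdN add0r.
Unshelve. all: by end_near. Qed.

End Bochner.

(** * Kaluza-Klein metrics *)

Section Pullback.
Variables (R : realType).

Lemma dder_linear (V W X : normedModType R) (L : {linear W -> X}) (f : V -> W) v x :
  continuous L -> differentiable f x ->
  dder (fun y => L (f y)) v x = L (dder f v x).
Proof.
move=> cL df; have dL : differentiable L (f x) by exact: linear_differentiable.
rewrite -!dderE !deriveE//; last exact: (differentiable_comp df dL).
by rewrite (diff_comp df dL)/= diff_lin.
Qed.

Lemma dder_precomp (V V' W : normedModType R) (L : {linear V -> V'}) (f : V' -> W) v x :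
  dder (fun y => f (L y)) v x = dder f (L v) (L x).
Proof.
rewrite -!dderE /derive.
have -> : (fun h : R => h^-1 *: (((fun y => f (L y)) \o shift x) (h *: v) - f (L x))) =
    (fun h : R => h^-1 *: ((f \o shift (L x)) (h *: L v) - f (L x))).
  by apply/funext => h /=; rewrite (linearD L) (linearZZ L).
by [].
Qed.

Lemma differentiable_precomp (V V' W : normedModType R) (L : {linear V -> V'})
    (f : V' -> W) x :
  continuous L -> differentiable f (L x) -> differentiable (fun y => f (L y)) x.
Proof.
by move=> cL df; exact: (differentiable_comp (linear_differentiable x cL) df).
Qed.

Lemma row_mx_mulE m n1 n2 (X : 'M[R]_(m, n1)) (Y : 'M[R]_(m, n2)) :
  row_mx X Y = X *m row_mx 1%:M 0 + Y *m row_mx 0 1%:M.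
Proof. by rewrite !mul_mx_row !mulmx1 !mulmx0 add_row_mx addr0 add0r. Qed.

Lemma dder_row_mx (V : normedModType R) m n1 n2
    (X : V -> 'M[R]_(m, n1)) (Y : V -> 'M[R]_(m, n2)) v x :
  differentiable X x -> differentiable Y x ->
  dder (fun y => row_mx (X y) (Y y)) v x = row_mx (dder X v x) (dder Y v x).
Proof.
move=> dX dY; rewrite (_ : (fun _ => _) = fun y =>
    X y *m row_mx 1%:M 0 + Y y *m row_mx 0 1%:M).
  rewrite dderD; last 2 first.
  - by apply: differentiable_mulmx => //; exact: differentiable_cst.
  - by apply: differentiable_mulmx => //; exact: differentiable_cst.
  rewrite (@dder_mulmx _ _ _ _ _ X (fun=> row_mx 1%:M 0))//.
  rewrite (@dder_mulmx _ _ _ _ _ Y (fun=> row_mx 0 1%:M))//.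
  by rewrite !dder_cst !mulmx0 !addr0 -row_mx_mulE.
by apply/funext => y; rewrite row_mx_mulE.
Qed.

Lemma dder_comp_eq0 (V : normedModType R) (F : R -> R) (f : V -> R) v x :
  differentiable f x -> differentiable F (f x) -> dder f v x = 0 ->
  dder (fun y => F (f y)) v x = 0.
Proof.
move=> df dF; rewrite -!dderE deriveE// deriveE => [df0|].
  by rewrite (@diff_comp _ _ _ _ f F x df dF)/= df0 linear0.
exact: (@differentiable_comp _ _ _ _ f F x df dF).
Qed.

Lemma gtrace_swap n (W : lmodType R) (S : 'M[R]_n) (b : 'rV[R]_n -> 'rV[R]_n -> W) :
  S^T = S -> gtrace S (fun u v => b v u) = gtrace S b.
Proof.
move=> Ssym; have VE : (invmx S)^T = invmx S by rewrite trmx_inv Ssym.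
rewrite /gtrace exchange_big/=; apply: eq_bigr => i _; apply: eq_bigr => j _.
by rewrite -{1}VE mxE.
Qed.

(** This is the expansion of [t] in an orthonormal basis, followed by [N]. *)
Lemma gtrace_contract n (S N : 'M[R]_n) t : S \in unitmx -> S^T = S ->
  gtrace S (fun u v => ip S u t *: (v *m N)) = t *m N.
Proof.
move=> uS Ssym; rewrite /gtrace exchange_big/=.
transitivity (\sum_(j < n) (t 0 j *: ((delta_mx 0 j : 'rV[R]_n) *m N))); last first.
  by rewrite [t in RHS]row_sum_delta mulmx_suml; apply: eq_bigr => j _; rewrite scalemxAl.
apply: eq_bigr => j _; under eq_bigr do rewrite scalerA.
rewrite -scaler_suml; congr (_ *: _).
rewrite -[t in RHS](mulmxK uS) [RHS]mxE; apply: eq_bigr => i _.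
by rewrite (ip_sym _ _ Ssym) ip_delta mulrC.
Qed.

Lemma gtrace_mul n (S N : 'M[R]_n) : S \in unitmx -> S^T = S ->
  gtrace (W := R^o) S (fun u v => ip S u (v *m N)) = \tr N.
Proof.
move=> uS Ssym; rewrite (@gtrace_mxtrace _ _ _ _ (S *m N^T)).
  by rewrite trmx_mul trmxK Ssym mulmxA mxtrace_mulC mulmxA mulmxV// mul1mx.
by move=> i j; rewrite -[X in ip _ X _]mulmx1 ip_delta_mul mul1mx.
Qed.

End Pullback.

(** * The connection of a Kaluza-Klein metric and the tension field of a section *)

Section KaluzaKlein.
Variables (R : realType) (n : nat) (U : set 'rV[R]_n).
Variable g : 'rV[R]_n -> 'M[R]_n.
Hypotheses (openU : open U) (g_smooth : smooth_on U g).
Hypothesis g_sym : forall x, U x -> (g x)^T = g x.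
Hypothesis g_pos : forall x u, U x -> u != 0 -> 0 < ip (g x) u u.
Variables (B C : R -> R) (G : 'rV[R]_(n + n) -> 'M[R]_(n + n)).
Hypotheses (dB : forall t, differentiable B t) (dC : forall t, differentiable C t).
Hypothesis G_sym : forall x e, U x -> (G (row_mx x e))^T = G (row_mx x e).
Hypothesis G_pos : forall x e z, U x -> z != 0 -> 0 < ip (G (row_mx x e)) z z.
Hypothesis G_hh : forall x e X Y, U x ->
  ip (G (row_mx x e)) (hlift g x e X) (hlift g x e Y) = ip (g x) X Y.
Hypothesis G_hv : forall x e X Y, U x ->
  ip (G (row_mx x e)) (hlift g x e X) (vlift Y) = 0.
Hypothesis G_vv : forall x e X Y, U x ->
  ip (G (row_mx x e)) (vlift X) (vlift Y) =
  B (ip (g x) e e) * ip (g x) X Y + C (ip (g x) e e) * ip (g x) X e * ip (g x) Y e.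
Implicit Types (x u v w e : 'rV[R]_n) (y z Z : 'rV[R]_(n + n)).

Let nearTU z : U (lsubmx z) -> \forall y \near z, U (lsubmx y).
Proof.
move=> Uz; have : nbhs (lsubmx z) U by exact: (@near_open R _ U openU).
exact: continuous_lsubmx.
Qed.

(* The vertical part of the constant field Z, in the notation of [vpart]. *)
Definition vcomp Z z : 'rV[R]_n :=
  rsubmx Z + rsubmx z *m chr g (lsubmx Z) (lsubmx z).

(** The squared length |e|^2, at which B and C are evaluated. *)
Definition fibre_norm z : R := ip (g (lsubmx z)) (rsubmx z) (rsubmx z).

(** The value of [G] on constant fields, written with [g], [B] and [C]; the differentiability of [G]
    and its derivatives are read off from it. *)
Definition kk_form Z Z' z : R :=
  ip (g (lsubmx z)) (lsubmx Z) (lsubmx Z')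
  + (B (fibre_norm z) * ip (g (lsubmx z)) (vcomp Z z) (vcomp Z' z)
     + C (fibre_norm z) * (ip (g (lsubmx z)) (vcomp Z z) (rsubmx z)
       * ip (g (lsubmx z)) (vcomp Z' z) (rsubmx z))).

Lemma kk_formE Z Z' z : U (lsubmx z) -> ip (G z) Z Z' = kk_form Z Z' z.
Proof.
rewrite -[z]hsubmxK; set x := lsubmx z; set e := rsubmx z.
rewrite row_mxKl => Ux; rewrite /kk_form /vcomp /fibre_norm !row_mxKl !row_mxKr.
have E Y : Y = hlift g x e (lsubmx Y) + vlift (rsubmx Y + e *m chr g (lsubmx Y) x).
  rewrite {1}(hlift_vlift_decomp g x e Y) /vpart /hpart.
  by rewrite -(chrE g_smooth g_pos)// gam.unlock.
rewrite {1}(E Z) {1}(E Z') [LHS]ipDl ![in LHS]ipDr G_hh// G_hv// G_vv//.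
by rewrite (ip_sym (vlift _) _ (G_sym _ Ux)) G_hv//; ring.
Qed.

Section AtPoint.
Variable z : 'rV[R]_(n + n).
Hypothesis Uz : U (lsubmx z).

Let cl : continuous (lsubmx : 'rV[R]_(n + n) -> 'rV[R]_n).
Proof. exact: continuous_lsubmx. Qed.
Let cr : continuous (rsubmx : 'rV[R]_(n + n) -> 'rV[R]_n).
Proof. exact: continuous_rsubmx. Qed.

Let dgp : differentiable (fun y : 'rV[R]_(n + n) => g (lsubmx y)) z.
Proof.
exact: (differentiable_precomp (L := lsubmx) cl (smooth_differentiable g_smooth Uz)).
Qed.

Let dchr u : differentiable (fun y : 'rV[R]_(n + n) => chr g u (lsubmx y)) z.
Proof.
have du := chr_differentiable openU g_smooth g_pos u Uz.
exact: (differentiable_precomp (L := lsubmx) cl du).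
Qed.

Let dr : differentiable (rsubmx : 'rV[R]_(n + n) -> 'rV[R]_n) z.
Proof. exact: differentiable_rsubmx. Qed.

Lemma vcomp_differentiable Z : differentiable (vcomp Z) z.
Proof.
apply: differentiableD; first exact: differentiable_cst.
exact: differentiable_mulmx.
Qed.

Let dv := vcomp_differentiable.

Lemma fibre_norm_differentiable : differentiable fibre_norm z.
Proof. exact: differentiable_ip. Qed.

Lemma kk_coeff_differentiable (F : R -> R) : (forall r : R, differentiable F r) ->
  differentiable (fun y => F (fibre_norm y)) z.
Proof.
move=> dF; have dn := fibre_norm_differentiable.
exact: (@differentiable_comp _ _ _ _ fibre_norm F z dn (dF _)).
Qed.

Lemma kk_form_differentiable Z Z' : differentiable (kk_form Z Z') z.
Proof.
apply: differentiableD.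
  by apply: differentiable_ip => //; exact: differentiable_cst.
apply: differentiableD; apply: differentiableM; try exact: kk_coeff_differentiable.
  exact: differentiable_ip.
by apply: differentiableM; exact: differentiable_ip.
Qed.

Lemma kk_differentiable : differentiable G z.
Proof.
apply/differentiable_mxP => i j.
apply: (@near_differentiable _ _ _ (kk_form (delta_mx 0 i) (delta_mx 0 j))); last first.
  exact: kk_form_differentiable.
near=> y; rewrite -kk_formE; last by near: y; exact: nearTU.
by rewrite ip_delta -rowE mxE.
Unshelve. all: by end_near. Qed.

Lemma dder_vcomp Z W : dder (vcomp Z) W z =
  rsubmx W *m chr g (lsubmx Z) (lsubmx z)
  + rsubmx z *m dder (chr g (lsubmx Z)) (lsubmx W) (lsubmx z).
Proof.
pose c (y : 'rV[R]_(n + n)) := chr g (lsubmx Z) (lsubmx y).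
have dc : differentiable c z by exact: dchr.
rewrite /vcomp (@dderD _ _ _ (fun=> rsubmx Z) (fun y => rsubmx y *m c y))//; last first.
  exact: differentiable_mulmx.
rewrite dder_cst add0r (@dder_mulmx _ _ _ _ _ rsubmx c)// /c.
rewrite (dder_precomp lsubmx (chr g (lsubmx Z))); congr (_ *m _ + _).
by rewrite (@dder_linear _ _ _ _ rsubmx id)// -dderE derive_id.
Qed.

Lemma dder_fibre_ip (X Y : 'rV[R]_(n + n) -> 'rV[R]_n) W :
  differentiable X z -> differentiable Y z ->
  dder (fun y => ip (g (lsubmx y)) (X y) (Y y)) W z =
  ip (g (lsubmx z)) (dder X W z + X z *m chr g (lsubmx W) (lsubmx z)) (Y z)
  + ip (g (lsubmx z)) (X z) (dder Y W z + Y z *m chr g (lsubmx W) (lsubmx z)).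
Proof.
move=> dX dY; rewrite dder_ip// (dder_precomp lsubmx g).
rewrite (metric_compat openU g_smooth g_sym g_pos)// !(chrE g_smooth g_pos)//.
by rewrite ipDl ipDr; ring.
Qed.

Lemma dder_rsubmx W : dder rsubmx W z = rsubmx W.
Proof. by rewrite (@dder_linear _ _ _ _ rsubmx id)// -dderE derive_id. Qed.

(** The covariant derivative along [W] of the vertical component of [Z], in the pull-back of the
    tangent bundle to the total space. *)
Let covcomp Z W := dder (vcomp Z) W z + vcomp Z z *m chr g (lsubmx W) (lsubmx z).

Let x := lsubmx z.
Let e := rsubmx z.

(** The product rule in the pulled-back connection; the factors [vcomp Y z] are the covariant
    derivative along [Y] of the tautological section e. *)
Lemma dder_kk_form Z Z' Y : dder (kk_form Z Z') Y z =
  ip (dder g (lsubmx Y) x) (lsubmx Z) (lsubmx Z')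
  + (dder (fun y => B (fibre_norm y)) Y z * ip (g x) (vcomp Z z) (vcomp Z' z)
     + B (fibre_norm z) * (ip (g x) (covcomp Z Y) (vcomp Z' z)
                           + ip (g x) (vcomp Z z) (covcomp Z' Y))
     + (dder (fun y => C (fibre_norm y)) Y z
          * (ip (g x) (vcomp Z z) e * ip (g x) (vcomp Z' z) e)
        + C (fibre_norm z) *
          ((ip (g x) (covcomp Z Y) e + ip (g x) (vcomp Z z) (vcomp Y z))
             * ip (g x) (vcomp Z' z) e
           + ip (g x) (vcomp Z z) e
             * (ip (g x) (covcomp Z' Y) e + ip (g x) (vcomp Z' z) (vcomp Y z))))).
Proof.
have dip X X' : differentiable X z -> differentiable X' z ->
    differentiable (fun y => ip (g (lsubmx y)) (X y) (X' y) : R) z.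
  by move=> dX dX'; exact: differentiable_ip.
pose b y : R := B (fibre_norm y); pose c y : R := C (fibre_norm y).
pose i0 y : R := ip (g (lsubmx y)) (lsubmx Z) (lsubmx Z').
pose i1 y : R := ip (g (lsubmx y)) (vcomp Z y) (vcomp Z' y).
pose i2 y : R := ip (g (lsubmx y)) (vcomp Z y) (rsubmx y).
pose i3 y : R := ip (g (lsubmx y)) (vcomp Z' y) (rsubmx y).
have d0 : differentiable i0 z by apply: dip; exact: differentiable_cst.
have d1 : differentiable i1 z by exact: dip.
have d2 : differentiable i2 z by exact: dip.
have d3 : differentiable i3 z by exact: dip.
have db : differentiable b z by exact: kk_coeff_differentiable.
have dc : differentiable c z by exact: kk_coeff_differentiable.
have d23 : differentiable (fun y => i2 y * i3 y) z by exact: differentiableM.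
rewrite -[LHS]/(dder (fun y => i0 y + (b y * i1 y + c y * (i2 y * i3 y))) Y z).
rewrite dderD//; last by apply: differentiableD; exact: differentiableM.
rewrite dderD; [|exact: differentiableM..].
rewrite !dderM//.
have -> : dder i0 Y z = ip (dder g (lsubmx Y) x) (lsubmx Z) (lsubmx Z').
  rewrite /i0 (dder_precomp lsubmx (fun p => ip (g p) (lsubmx Z) (lsubmx Z') : R)).
  by rewrite (dder_metric_cst g_smooth).
by rewrite /i1 /i2 /i3 !dder_fibre_ip// !dder_rsubmx.
Qed.

Variable W : 'rV[R]_(n + n).
Hypothesis W_horizontal : vcomp W z = 0.

Lemma dder_fibre_norm : dder fibre_norm W z = 0.
Proof.
rewrite /fibre_norm dder_fibre_ip// dder_rsubmx -/(vcomp W z) W_horizontal.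
by rewrite ip0l ip0r addr0.
Qed.

Lemma dder_kk_coeff (F : R -> R) : (forall r : R, differentiable F r) ->
  dder (fun y => F (fibre_norm y)) W z = 0.
Proof.
move=> dF; apply: dder_comp_eq0 => //; first exact: fibre_norm_differentiable.
exact: dder_fibre_norm.
Qed.

(** Exchanging the two fields costs the curvature, as for the bracket of horizontal lifts.
    Horizontality of [W] at [z] expresses [rsubmx W] by a Christoffel term, which supplies one of
    the products in [curv]. *)
Lemma covcomp_horizontal Z :
  covcomp Z W = covcomp W Z + e *m curv g (lsubmx W) (lsubmx Z) x.
Proof.
have rW : rsubmx W = - (e *m chr g (lsubmx W) x).
  by apply/eqP; rewrite -addr_eq0; exact/eqP/W_horizontal.
rewrite /covcomp W_horizontal mul0mx addr0 !dder_vcomp rW /curv /vcomp -/x -/e.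
rewrite mulNmx !(mulmxDr, mulmxDl) !mulmxN !mulmxA.
set a := e *m _ *m _; set b := e *m dder _ _ _; set c := rsubmx Z *m _.
set d := e *m _ *m _; set f := e *m dder _ _ _.
clearbody a b c d f.
by apply/rowP => k; rewrite !mxE; ring.
Qed.

Lemma koszul_kk Z Z' : koszul G z Z Z' W =
  koszul g x (lsubmx Z) (lsubmx Z') (lsubmx W)
  - 2^-1 * B (fibre_norm z) *
    (ip (g x) (e *m curv g (lsubmx W) (lsubmx Z) x) (vcomp Z' z)
     + ip (g x) (e *m curv g (lsubmx W) (lsubmx Z') x) (vcomp Z z)).
Proof.
have E Z1 Z2 Z3 : 'D_Z3 (fun y => ip (G y) Z1 Z2 : R^o) z = dder (kk_form Z1 Z2) Z3 z.
  rewrite dderE; apply: dder_near; near=> y; apply: kk_formE.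
  by near: y; exact: nearTU.
rewrite /koszul !E !dder_kk_form W_horizontal !(dder_kk_coeff dB, dder_kk_coeff dC).
rewrite -/(koszul _ _ _ _ _) (koszulE g_smooth)// !covcomp_horizontal.
have skew := curv_skew openU g_smooth g_sym g_pos (lsubmx W) _ e Uz.
have := skew (lsubmx Z); have := skew (lsubmx Z').
move: (e *m curv _ _ (lsubmx Z) _) (e *m curv _ _ (lsubmx Z') _) => K K' K0' K0.
move: (vcomp Z z) (vcomp Z' z) (covcomp W Z) (covcomp W Z') => P P' Q Q'.
have gC a b : ip (g x) a b = ip (g x) b a by exact: ip_sym (g_sym Uz).
rewrite !ip0l !ip0r !ipDl !ipDr K0 K0' (gC P' Q) !(gC P Q') (gC P K').
ring.
Unshelve. all: by end_near. Qed.

End AtPoint.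

Variable kappa : R.
Hypothesis g_curv : forall x u v, U x -> row_free (col_mx u v) ->
  sectional g x u v = kappa.

Lemma lsubmx_gam_kk Z Z' z : U (lsubmx z) ->
  lsubmx (gam G z Z Z') = gam g (lsubmx z) (lsubmx Z) (lsubmx Z')
  - (2^-1 * B (fibre_norm z) * kappa) *:
    (ip (g (lsubmx z)) (lsubmx Z) (rsubmx z) *: vcomp Z' z
     - ip (g (lsubmx z)) (lsubmx Z) (vcomp Z' z) *: rsubmx z
     + (ip (g (lsubmx z)) (lsubmx Z') (rsubmx z) *: vcomp Z z
        - ip (g (lsubmx z)) (lsubmx Z') (vcomp Z z) *: rsubmx z)).
Proof.
move=> Uz; apply: (metric_inj g_pos Uz) => w.
set x := lsubmx z; set e := rsubmx z.
have gC a b : ip (g x) a b = ip (g x) b a by exact: ip_sym (g_sym Uz).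
(* Under [G], pairing with the horizontal lift of [w] is pairing the horizontal part with [w] under
   [g]. *)
pose W := hlift g x e w.
have lW : lsubmx W = w by rewrite /W /hlift row_mxKl.
have W0 : vcomp W z = 0.
  by rewrite /vcomp lW /W /hlift row_mxKr -(chrE g_smooth g_pos)// gam.unlock addNr.
have -> : ip (g x) (lsubmx (gam G z Z Z')) w = koszul G z Z Z' W.
  rewrite -ip_gam; [|exact: kk_differentiable|]; last first.
    by apply: posdef_unitmx => y; rewrite -[z]hsubmxK; exact: G_pos.
  by rewrite kk_formE// /kk_form W0 !ip0r !ip0l !mulr0 !addr0 lW.
rewrite (koszul_kk _ W0)// lW !(curv_const openU g_smooth g_sym g_pos g_curv)//.
rewrite -(ip_christoffel g_smooth g_pos)// -/x -/e.
move: (vcomp Z z) (vcomp Z' z) (lsubmx Z) (lsubmx Z') (gam _ _ _ _) => P P' u u' y.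
rewrite ipBl ipZl !(ipDl, ipNl, ipZl) !(gC _ w).
by ring.
Qed.

Variable s : 'rV[R]_n -> 'rV[R]_n.
Hypothesis s_smooth : smooth_on U s.

(** The base component of the section is the identity, so its second derivative vanishes and the two
    Christoffel terms of [g] cancel. The vertical component of its differential on [a] is nabla_a
    s. *)
Lemma lsubmx_second_fundamental_form x u v : U x ->
  let t := s x in let N := cov_mx g s x in
  lsubmx (second_fundamental_form g G (fun p : 'rV[R]_n => row_mx p (s p)) x u v) =
  - (2^-1 * B (ip (g x) t t) * kappa) *:
    (ip (g x) u t *: (v *m N) - ip (g x) u (v *m N) *: t
     + (ip (g x) v t *: (u *m N) - ip (g x) v (u *m N) *: t)).
Proof.
move=> Ux t N; set sg := fun p : 'rV[R]_n => row_mx p (s p).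
have dsg a p : U p -> dder sg a p = row_mx a (dder s a p).
  move=> Up; rewrite (@dder_row_mx _ _ _ _ _ id s)//.
    by rewrite -(dderE id) derive_id.
  exact: smooth_differentiable s_smooth Up.
have dd : lsubmx ('D_u ('D_v sg) x) = 0.
  have -> : 'D_u ('D_v sg) x = row_mx 0 (dder (dder s v) u x).
    rewrite -(dder_cst v u x) -(@dder_row_mx _ _ _ _ _ (fun=> v) (dder s v))//; last first.
      exact: smooth_differentiable (smooth_dder v s_smooth) Ux.
    rewrite dderE; apply: dder_near; near=> y; rewrite dderE dsg//.
    by near: y; exact: (@near_open R _ U openU).
  by rewrite row_mxKl.
rewrite /second_fundamental_form linearB linearD/= dd add0r !dderE !dsg// row_mxKl.
have -> : christoffel G (sg x) (row_mx u (dder s u x)) (row_mx v (dder s v x)) =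
    gam G (sg x) (row_mx u (dder s u x)) (row_mx v (dder s v x)) by rewrite gam.unlock.
have lx : lsubmx (sg x) = x by rewrite row_mxKl.
have rx : rsubmx (sg x) = s x by rewrite row_mxKr.
rewrite lsubmx_gam_kk lx// /fibre_norm lx rx !row_mxKl.
have vc a : vcomp (row_mx a (dder s a x)) (sg x) = a *m N.
  rewrite /vcomp row_mxKl row_mxKr lx rx /N.
  by rewrite -(cov_mxE openU g_smooth g_sym g_pos s_smooth).
rewrite !vc gam.unlock -/t scaleNr.
by rewrite addrAC subrr add0r.
Unshelve. all: by end_near. Qed.

(** The two halves of the second fundamental form differ by exchanging its arguments, hence have
    equal traces; their sum absorbs the factor 1/2. *)
Lemma hpart_tension x : U x ->
  hpart (tension g G (fun p : 'rV[R]_n => row_mx p (s p)) x) =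
  - (B (ip (g x) (s x) (s x)) * kappa) *:
    (cov g s (s x) x - divergence g s x *: s x).
Proof.
move=> Ux; set t := s x; set N := cov_mx g s x.
have gu := metric_unitmx g_pos Ux; have gs := g_sym Ux.
rewrite (cov_mxE openU g_smooth g_sym g_pos s_smooth)//.
rewrite (divergenceE g_smooth g_pos s)// -/t -/N.
pose b1 u v : 'rV[R]_n := ip (g x) u t *: (v *m N).
pose b2 u v : R^o := ip (g x) u (v *m N).
have t1 : gtrace (g x) b1 = t *m N by exact: gtrace_contract.
have t1' : gtrace (g x) (fun u v => b1 v u) = t *m N by rewrite gtrace_swap.
have t2 : gtrace (g x) b2 = \tr N by exact: gtrace_mul.
have t2' : gtrace (g x) (fun u v => b2 v u) = \tr N by rewrite gtrace_swap.
pose c := - (2^-1 * B (ip (g x) t t) * kappa).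
transitivity (c *: (gtrace (g x) b1 - gtrace (g x) b2 *: t
    + (gtrace (g x) (fun u v => b1 v u) - gtrace (g x) (fun u v => b2 v u) *: t))).
  rewrite /hpart /tension /gtrace.
  rewrite !linear_sum/= !scaler_suml -!sumrB -big_split/= scaler_sumr.
  apply: eq_bigr => i _.
  rewrite !linear_sum/= !scaler_suml -!sumrB -big_split/= scaler_sumr.
  apply: eq_bigr => j _.
  rewrite linearZ/= lsubmx_second_fundamental_form//.
  move: (invmx _ _ _) => q; rewrite -/c.
  rewrite -!scalerA -!scalerBr -scalerDr !scalerA mulrC.
  by [].
rewrite t1 t1' t2 t2' -mulr2n -scaler_nat scalerA; congr (_ *: _).
by rewrite /c; field.
Qed.

End KaluzaKlein.

(** * Fields of constant length *)

Section ConstantLength.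
Variables (R : realType) (n : nat) (U : set 'rV[R]_n).
Variable g : 'rV[R]_n -> 'M[R]_n.
Hypotheses (openU : open U) (g_smooth : smooth_on U g).
Hypothesis g_sym : forall x, U x -> (g x)^T = g x.
Hypothesis g_pos : forall x u, U x -> u != 0 -> 0 < ip (g x) u u.
Variables (s : 'rV[R]_n -> 'rV[R]_n) (kappa k b : R).
Hypothesis s_smooth : smooth_on U s.
Hypothesis g_curv : forall x u v, U x -> row_free (col_mx u v) ->
  sectional g x u v = kappa.
Hypothesis kappa_neq0 : kappa != 0.
Hypothesis s_length : forall x, U x -> ip (g x) (s x) (s x) = k ^+ 2.
(** [b] stands for [B (k ^+ 2)]. Along [s] itself positivity of [G] bounds only a combination of B
    and C, so the sign of [b] is drawn from a vector orthogonal to [s]. *)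
Hypothesis b_gt0 : forall x u, U x -> u != 0 -> ip (g x) u (s x) = 0 -> 0 < b.
Hypothesis s_tau_h : forall x, U x ->
  (b * kappa) *: (cov g s (s x) x - divergence g s x *: s x) = 0.
Implicit Types (x u v w : 'rV[R]_n).

Lemma cov_orthogonal x u : U x -> ip (g x) (cov g s u x) (s x) = 0.
Proof.
move=> Ux; have ds := smooth_differentiable s_smooth Ux.
have := cov_compat openU g_smooth g_sym g_pos u Ux ds ds.
rewrite (@dder_near _ _ _ _ (fun=> k ^+ 2)) ?dder_cst; last first.
  by near=> y; apply: s_length; near: y; exact: (@near_open R _ U openU).
by rewrite (ip_sym (s x) _ (g_sym Ux)) => h; lra.
Unshelve. all: by end_near. Qed.

(** Either alternative makes both the divergence and nabla_s s vanish at [x]; the second also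
    records that n is at least 2, which the rigidity estimates use. *)
Lemma parallel_or_geodesic x : U x ->
  cov_mx g s x = 0 \/
  [/\ (1 < n)%N, divergence g s x = 0 & cov g s (s x) x = 0].
Proof.
move=> Ux; have [->|] := eqVneq (cov_mx g s x) 0; first by left.
move=> N0; right.
have [u u0] : exists u, cov g s u x != 0.
  apply/not_existsP => h; case/eqP: N0; apply/row_matrixP => i.
  by rewrite rowK row0; apply/eqP/negPn/negP; exact: h.
have ut := cov_orthogonal u Ux.
have b0 := b_gt0 Ux u0 ut.
(* If k were 0, [s] would vanish near [x] and so would its derivative. *)
have k0 : k ^+ 2 != 0.
  apply: contraNN u0 => /eqP k0.
  have s0 y : U y -> s y = 0 by move=> Uy; apply: (metric_eq0 g_pos Uy); rewrite s_length.
  rewrite /cov s0// mul0mx addr0 (@dder_near _ _ _ _ (fun=> 0)) ?dder_cst//.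
  by near=> y; apply: s0; near: y; exact: (@near_open R _ U openU).
have /eqP := s_tau_h Ux; rewrite scaler_eq0 mulf_eq0 gt_eqF//= (negbTE kappa_neq0)/=.
rewrite subr_eq0 => /eqP covE.
have div0 : divergence g s x = 0.
  apply: (mulIf k0); rewrite mul0r -(s_length Ux) -ipZl -covE.
  exact: cov_orthogonal.
split=> //; last by rewrite covE div0 scale0r.
(* Nonzero and orthogonal, the two vectors are independent, and a matrix of rank 2 has at least two
   columns. *)
have fr : row_free (col_mx (cov g s u x) (s x)).
  apply: gram_row_free (g_sym Ux) _; rewrite ut expr0n subr0 mulf_neq0//.
    by rewrite gt_eqF// g_pos.
  by rewrite s_length.
by have := rank_leq_col (col_mx (cov g s u x) (s x)); rewrite (eqP fr).
Unshelve. all: by end_near. Qed.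

Lemma constant_length_div x : U x -> divergence g s x = 0.
Proof.
move=> Ux; have [N0|[]//] := parallel_or_geodesic Ux.
by rewrite (divergenceE g_smooth g_pos s)// N0 mxtrace0.
Qed.

Lemma constant_length_geodesic x : U x -> cov g s (s x) x = 0.
Proof.
move=> Ux; have [N0|[]//] := parallel_or_geodesic Ux.
by rewrite (cov_mxE openU g_smooth g_sym g_pos s_smooth)// N0 mulmx0.
Qed.

Lemma normsq_lie_const x : U x -> normsq_lie g s x =
  2 * normsq_nabla g s x - 2 * (n%:R - 1) * (kappa * k ^+ 2).
Proof.
move=> Ux; rewrite (normsq_lie_nabla openU g_smooth g_sym g_pos s_smooth)//.
have := bochner openU g_smooth g_sym g_pos s_smooth g_curv constant_length_geodesic
  constant_length_div Ux.
by rewrite s_length//; lra.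
Qed.

(** Since 0 <= |N|^2 <= kappa k^2 and n - 1 >= 1, the formula |L|^2 = 2 |N|^2 - 2 (n - 1) kappa k^2
    gives |L|^2 <= 0. *)
Lemma lie_mx_eq0 x : U x -> normsq_nabla g s x <= kappa * k ^+ 2 -> lie_mx g s x = 0.
Proof.
move=> Ux N_le; have [N0|[n2 _ _]] := parallel_or_geodesic Ux.
  by rewrite /lie_mx N0 mul0mx trmx0 mulmx0 addr0.
have n1 : 1 <= n%:R - 1 :> R by rewrite lerBrDr -[1 + 1]/(2%:R) ler_nat.
have [_] := mxtrace_lie_frobenius (lie_mx g s x) (g_sym Ux) (fun u => @g_pos x u Ux).
rewrite -(normsq_lieE openU g_smooth g_sym g_pos s_smooth)//; apply.
have [] := mxtrace_nabla_frobenius (cov_mx g s x) (g_sym Ux) (fun u => @g_pos x u Ux).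
rewrite -(normsq_nablaE openU g_smooth g_sym g_pos s_smooth)// => N_ge0 _.
rewrite normsq_lie_const//.
move: (normsq_nabla _ _ _) (kappa * _) (n%:R - 1) N_le N_ge0 n1 => a q m aq a0 m1.
by nra.
Qed.

(** From 0 <= |L|^2 <= - 2 kappa k^2 follows kappa k^2 <= 0; then 2 |N|^2 = |L|^2 + 2 (n - 1) kappa
    k^2 <= 2 (n - 2) kappa k^2 <= 0. *)
Lemma cov_mx_eq0 x : U x -> normsq_lie g s x <= - 2 * kappa * k ^+ 2 -> cov_mx g s x = 0.
Proof.
move=> Ux L_le; have [//|[n2 _ _]] := parallel_or_geodesic Ux.
have n1 : 1 <= n%:R - 1 :> R by rewrite lerBrDr -[1 + 1]/(2%:R) ler_nat.
have [] := mxtrace_lie_frobenius (lie_mx g s x) (g_sym Ux) (fun u => @g_pos x u Ux).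
rewrite -(normsq_lieE openU g_smooth g_sym g_pos s_smooth)// => L_ge0 _.
have [_] := mxtrace_nabla_frobenius (cov_mx g s x) (g_sym Ux) (fun u => @g_pos x u Ux).
rewrite -(normsq_nablaE openU g_smooth g_sym g_pos s_smooth)//; apply.
move: L_le L_ge0; rewrite -mulrA normsq_lie_const//.
move: (normsq_nabla _ _ _) (kappa * _) (n%:R - 1) n1 => a q m m1 L_le L_ge0.
by nra.
Qed.

End ConstantLength.

(** * From the charts to the manifold *)

Unset Implicit Arguments.

Theorem proposition3p1 (R : realType) (n : nat) (M : manifold R n)
    (g : riemannian_metric M) (kappa : R) (A B C : R -> R)
    (G : kaluza_klein g A B C) (s : vector_field M)
    (hkappa : constant_curvature g kappa)
    (hA : forall t, 0 <= t -> A t = 1) :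
  (forall c x, img c x ->
     tau_h G s c x =
     - (B (ip (g c x) (s c x) (s c x)) * kappa) *:
       (nabla (g c) (s c) (s c) x - divergence (g c) (s c) x *: s c x))
  /\ (compact [set: M] -> kappa != 0 ->
      forall k : R, constant_length g s k -> harmonic_section G s ->
      [/\ forall c x, img c x -> divergence (g c) (s c) x = 0,
          forall c x, img c x -> nabla (g c) (s c) (s c) x = 0,
          (forall c x, img c x ->
             normsq_nabla (g c) (s c) x <= kappa * k ^+ 2) -> killing g s
        & (forall c x, img c x ->
             normsq_lie (g c) (s c) x <= - 2 * kappa * k ^+ 2) ->
          parallel g s]).
Proof.
have openU (c : chart M) : open (img c) by exact: coord_open.
have gS c := @Defs.metric_smooth _ _ _ g c.
have gT c := @Defs.metric_sym _ _ _ g c.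
have gP c := @Defs.metric_pos _ _ _ g c.
have sS c := @vf_smooth _ _ _ s c.
have ip_ge0 c x e : img c x -> 0 <= ip (g c x) e e.
  by move=> Ux; have [->|e0] := eqVneq e 0; [rewrite ip0l|exact/ltW/gP].
(* The chart computations differentiate B and C as functions on the whole line, so they run on the
   extensions, which agree with B and C at squared lengths. *)
have [B' [[dB' _] BE]] := kk_B_C2 G.
have [C' [[dC' _] CE]] := kk_C_C2 G.
have tauE c x : img c x -> tau_h G s c x =
    - (B (ip (g c x) (s c x) (s c x)) * kappa) *:
    (cov (g c) (s c) (s c x) x - divergence (g c) (s c) x *: s c x).
  move=> Ux; rewrite -BE ?ip_ge0//.
  apply: (@hpart_tension _ _ _ _ (openU c) (gS c) (gT c) (gP c) B' C' (G c)) => //.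
  - by move=> t; exact: dB'.
  - by move=> t; exact: dC'.
  - by move=> y e; exact: kk_sym.
  - by move=> y e z; exact: kk_pos.
  - by move=> y e X Y Uy; rewrite kk_hh// hA ?mul1r// ip_ge0.
  - by move=> y e X Y; exact: kk_hv.
  - by move=> y e X Y Uy; rewrite kk_vv// BE ?CE ?ip_ge0.
  - exact: hkappa.
have nabE c x u : img c x -> nabla (g c) u (s c) x = cov (g c) (s c) (u x) x.
  by move=> Ux; exact: nablaE (gS c) (gP c) _ _ _ Ux.
split=> [c x Ux|_ kappa0 k s_len s_harm]; first by rewrite tauE// nabE.
have len c x : img c x -> ip (g c x) (s c x) (s c x) = k ^+ 2.
  by move=> Ux; rewrite -(s_len c x Ux) sqr_sqrtr// ip_ge0.
(* On the vertical lift of a vector orthogonal to [s] the C-term vanishes, and positivity of [G]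
   reads B(k^2) |u|^2 > 0. *)
have b_gt0 c x u : img c x -> u != 0 -> ip (g c x) u (s c x) = 0 -> 0 < B (k ^+ 2).
  move=> Ux u0 us; have u0' : vlift u != 0.
    by apply: contraNN u0 => /eqP /(congr1 rsubmx); rewrite /vlift row_mxKr raddf0 => ->.
  have := kk_pos G (s c x) Ux u0'; rewrite kk_vv// us !mulr0 addr0 len//.
  by rewrite pmulr_lgt0// gP.
have tau0 c x : img c x -> (B (k ^+ 2) * kappa) *:
    (cov (g c) (s c) (s c x) x - divergence (g c) (s c) x *: s c x) = 0.
  move=> Ux; apply/eqP; rewrite -oppr_eq0 -scaleNr; apply/eqP.
  by rewrite -(len c x Ux) -tauE// /tau_h s_harm// /hpart raddf0.
have div0 c x : img c x -> divergence (g c) (s c) x = 0.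
  exact: (constant_length_div (openU c) (gS c) (gT c) (gP c) (sS c) kappa0
    (len c) (b_gt0 c) (tau0 c)).
split=> // [c x Ux|N_le c x u v Ux|L_le c x u Ux].
- rewrite nabE//; exact: (constant_length_geodesic (openU c) (gS c) (gT c) (gP c)
    (sS c) kappa0 (len c) (b_gt0 c) (tau0 c)).
- rewrite (lie_metric_mx (openU c) (gS c) (gT c) (gP c) (sS c))//.
  rewrite (lie_mx_eq0 (openU c) (gS c) (gT c) (gP c) (sS c) (hkappa c) kappa0
    (len c) (b_gt0 c) (tau0 c))//; last exact: N_le.
  by rewrite ipE mulmx0 mul0mx mxE.
- rewrite nabE// (cov_mxE (openU c) (gS c) (gT c) (gP c) (sS c))//.
  rewrite (cov_mx_eq0 (openU c) (gS c) (gT c) (gP c) (sS c) (hkappa c) kappa0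
    (len c) (b_gt0 c) (tau0 c))//; last exact: L_le.
  exact: mulmx0.
Qed.
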